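(* The singular point $(0,0)$ of the curve $S$ given by $y(x+2y)(y^2+x)(y^2-x)=0$ has the following set of induced relations: $$\text{(1) } x_5x_4x_3x_2=x_2x_5x_4x_3=x_3x_2x_5x_4,$$ $$\text{(2) } x_4x_5x_4x_3x_2x_5=x_5x_4x_3x_2x_5x_4,$$ $$\text{(3) } x_1=x_5x_4x_5^{-1},\qquad \text{(4) } x_5=x_6,$$ where $\{x_1,\dots,x_6\}$ are the generators of the standard g-base.
   Context: Let $E=\{x\in\mathbb{C}:|x|\le 1\}$, $D=\{y\in\mathbb{C}:|y|\le 4\}$, regard $S$ as a curve in $E\times D$; its fibers over $E$ have $6$ points except over $x=0$. The fiber over $x=1$ is $K=\{-1,-\frac12,0,1,i,-i\}\subset D$. Let $u_0=-4i$. A motion of a finite set in $D$ consists of continuous functions $m_i:[0,1]\to D$ with pairwise distinct values at each time, starting at the points of the set. It is realized by a continuous family of diffeomorphisms $D_t$ of $D$, $D_0=\mathrm{Id}$, equal to the identity on $\partial D$, with $D_t(m_i(0))=m_i(t)$; we say it induces $D_1$. The local braid monodromy $\beta$ of $S$ at $(0,0)$ is the braid (class of a diffeomorphism of $D$ preserving $K$, identity on $\partial D$, up to having the same action on $\pi_1(D-K,u_0)$) induced by the motion formed by the points of $S$ over $x=e^{2\pi i t}$, $0\le t\le 1$. Standard g-base for this fiber, which has two non-real points: in the model set of real points $p_1=-1,\ p_2=-\frac12,\ p_3=0,\ p_4=1,\ p_5=2,\ p_6=3$, let the $i$-th loop go from $u_0$ along the straight segment to near $p_i$, once counterclockwise around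 $p_i$ on a small circle, and back. Move the model set to $K$ as follows, keeping $p_1,\dots,p_4$ fixed: rotate $p_5,p_6$ by $90^\circ$ counterclockwise about their midpoint $\frac52$ (so $p_5$ becomes the lower point $\frac52-\frac i2$ and $p_6$ the upper point $\frac52+\frac i2$), move them vertically to $\frac52-i$ and $\frac52+i$, and then horizontally to the left to $-i$ and $i$ respectively; the path leading to $p_3=0$ is thereby pushed to the left of $-i$. The loops $x_1,\dots,x_6$ are the images of the six loops under the diffeomorphism induced by this motion. In a product of loops the left factor is traversed first. The group $\pi_1(D-K,u_0)$ is free on $x_1,\dots,x_6$. The relations induced by $\beta$ are $\beta(x_j)=x_j$, $j=1,\dots,6$. Saying that the singular point ''has the set of induced relations $R$'' means that $R$ and $\{\beta(x_j)=x_j\}_j$ have the same normal closure in the free group on $x_1,\dots,x_6$. *)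

(* Defs.v *)
(* Stdlib reals with Coquelicot; the complex plane is Coquelicot's C = R * R. *)
From Stdlib Require Import Reals List Lia Lra.
From Coquelicot Require Import Coquelicot.
Import ListNotations.

Open Scope R_scope.

Definition I01 (t : R) : Prop := 0 <= t <= 1.

Definition disk (y : C) : Prop := Cmod y <= 4.

Definition expi (a : R) : C := (cos a, sin a).

(** ** Smooth maps of the closed disk *)

Fixpoint Ck (n : nat) (U : C -> Prop) (f : C -> R) : Prop :=
  (forall z, U z -> continuous f z) /\
  match n with
  | O => True
  | S k =>
      (forall z, U z -> ex_derive (fun s => f (s, snd z)) (fst z)
                     /\ ex_derive (fun s => f (fst z, s)) (snd z)) /\
      Ck k U (fun z => Derive (fun s => f (s, snd z)) (fst z)) /\
      Ck k U (fun z => Derive (fun s => f (fst z, s)) (snd z))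
  end.

(* Smoothness up to the boundary: a smooth extension to an open set exists. *)
Definition smooth_on_disk (f : C -> C) : Prop :=
  exists (U : C -> Prop) (g : C -> C),
    open U /\ (forall z, disk z -> U z /\ g z = f z) /\
    forall n, Ck n U (fun z => fst (g z)) /\ Ck n U (fun z => snd (g z)).

Definition disk_diffeo (f : C -> C) : Prop :=
  smooth_on_disk f /\ (forall z, disk z -> disk (f z)) /\
  exists g : C -> C,
    smooth_on_disk g /\ (forall z, disk z -> disk (g z)) /\
    (forall z, disk z -> g (f z) = z /\ f (g z) = z).

(** ** Motions of [n] points of the disk, indexed by [1 <= i <= n] *)

Definition is_motion (n : nat) (P : C -> Prop) (m : nat -> R -> C) : Prop :=
  (forall i, (1 <= i <= n)%nat ->
     continuous_on I01 (m i) /\ forall t, I01 t -> disk (m i t)) /\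
  (forall i j t, (1 <= i <= n)%nat -> (1 <= j <= n)%nat -> I01 t ->
     m i t = m j t -> i = j) /\
  (forall z, P z <-> exists i, (1 <= i <= n)%nat /\ m i 0 = z).

Definition realizes (n : nat) (m : nat -> R -> C) (F : R -> C -> C) : Prop :=
  continuous_on (fun p : R * C => I01 (fst p) /\ disk (snd p))
                (fun p : R * C => F (fst p) (snd p)) /\
  (forall t, I01 t -> disk_diffeo (F t)) /\
  (forall z, disk z -> F 0 z = z) /\
  (forall t z, I01 t -> Cmod z = 4 -> F t z = z) /\
  (forall i t, (1 <= i <= n)%nat -> I01 t -> F t (m i 0) = m i t).

Definition induces (n : nat) (m : nat -> R -> C) (f : C -> C) : Prop :=
  exists F, realizes n m F /\ forall z, disk z -> f z = F 1 z.

(** ** Loops and the fundamental group *)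

(* Only the values of a path on [0,1] matter. *)
Definition path := R -> C.

(* The left factor is traversed first. *)
Definition path_mul (a b : path) : path :=
  fun s => if Rle_dec s (1 / 2) then a (2 * s) else b (2 * s - 1).

Definition path_inv (a : path) : path := fun s => a (1 - s).

Declare Scope path_scope.
Delimit Scope path_scope with path.
Bind Scope path_scope with path.
Notation "a ** b" := (path_mul a b) (at level 40, left associativity) : path_scope.
Notation "a ^-1" := (path_inv a) (at level 3, left associativity, format "a ^-1")
  : path_scope.

Definition is_loop (X : C -> Prop) (u : C) (a : path) : Prop :=
  continuous_on I01 a /\ (forall s, I01 s -> X (a s)) /\ a 0 = u /\ a 1 = u.

Definition homotopic (X : C -> Prop) (u : C) (a b : path) : Prop :=
  exists H : R * R -> C,
    continuous_on (fun p => I01 (fst p) /\ I01 (snd p)) H /\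
    (forall t s, I01 t -> I01 s -> X (H (t, s))) /\
    (forall s, I01 s -> H (0, s) = a s /\ H (1, s) = b s) /\
    (forall t, I01 t -> H (t, 0) = u /\ H (t, 1) = u).

(* The loops whose class lies in the normal closure, in pi_1(X,u), of the
   elements [a b^-1] with [(a, b)] among the relations [rels], i.e. the least
   normal subgroup containing them, as a set of loops stable under homotopy. *)
Inductive normal_closure (X : C -> Prop) (u : C) (rels : list (path * path))
  : path -> Prop :=
| nc_rel a b : In (a, b) rels -> is_loop X u a -> is_loop X u b ->
    normal_closure X u rels (a ** b^-1)%path
| nc_one : X u -> normal_closure X u rels (fun _ => u)
| nc_mul a b : normal_closure X u rels a -> normal_closure X u rels b ->
    normal_closure X u rels (a ** b)%path
| nc_inv a : normal_closure X u rels a -> normal_closure X u rels (a^-1)%path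
| nc_conj a c : normal_closure X u rels a -> is_loop X u c ->
    normal_closure X u rels (c ** a ** c^-1)%path
| nc_homotopic a b : normal_closure X u rels a -> homotopic X u a b ->
    normal_closure X u rels b.

Definition same_normal_closure (X : C -> Prop) (u : C)
    (rels rels' : list (path * path)) : Prop :=
  forall a, normal_closure X u rels a <-> normal_closure X u rels' a.

(** ** The curve, its fiber over 1 and its local braid monodromy *)

Definition curve (x y : C) : Prop :=
  Cmod x <= 1 /\ disk y /\
  (y * (x + 2 * y) * (y * y + x) * (y * y - x) = 0)%C.

Definition K (y : C) : Prop :=
  In y [RtoC (-1); RtoC (- / 2); RtoC 0; RtoC 1; Ci; (- Ci)%C].

Definition u0 : C := (- (4 * Ci))%C.

Definition punctured_disk (y : C) : Prop := disk y /\ ~ K y.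

(* The points of the moving set at time [t] are exactly the points of the curve
   over [exp(2 i pi t)]; their labelling is immaterial. *)
Definition local_braid_monodromy (beta : C -> C) : Prop :=
  exists m : nat -> R -> C,
    is_motion 6 K m /\
    (forall t y, I01 t ->
       (curve (expi (2 * PI * t)) y <-> exists i, (1 <= i <= 6)%nat /\ m i t = y)) /\
    induces 6 m beta.

(** ** The standard g-base *)

Definition model_point (i : nat) : C :=
  match i with
  | 1%nat => RtoC (-1)
  | 2%nat => RtoC (- / 2)
  | 3%nat => RtoC 0
  | 4%nat => RtoC 1
  | 5%nat => RtoC 2
  | _ => RtoC 3
  end.

(* The two moving points stay opposite to each other with respect to their
   midpoint: they are [pair_center t -/+ pair_offset t]. *)
Definition pair_center (t : R) : C :=
  if Rle_dec t (2 / 3) then RtoC (5 / 2) else RtoC (5 / 2 * (3 - 3 * t)).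

Definition pair_offset (t : R) : C :=
  if Rle_dec t (1 / 3) then (/ 2 * expi (PI / 2 * (3 * t)))%C
  else if Rle_dec t (2 / 3) then (RtoC (/ 2 + / 2 * (3 * t - 1)) * Ci)%C
  else Ci.

(* Rotation on [0,1/3], vertical motion on [1/3,2/3], horizontal motion on
   [2/3,1]. *)
Definition model_motion (i : nat) (t : R) : C :=
  match i with
  | 5%nat => (pair_center t - pair_offset t)%C
  | 6%nat => (pair_center t + pair_offset t)%C
  | _ => model_point i
  end.

Definition segment (a b : C) : path := fun s => (a + s * (b - a))%C.

Definition circle (p e : C) : path := fun s => (p + (e - p) * expi (2 * PI * s))%C.

(* From [u0] straight to the point [e] at distance [r] from [p], once
   counterclockwise around [p] on the circle of radius [r], and back. *)
Definition lasso (r : R) (p : C) : path :=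
  let e := (p + r * ((u0 - p) / Cmod (u0 - p)))%C in
  (segment u0 e ** circle p e ** segment e u0)%path.

Definition image (f : C -> C) (a : path) : path := fun s => f (a s).

(* [psi] is a diffeomorphism induced by [model_motion]. *)
Definition gbase (psi : C -> C) (r : R) (i : nat) : path :=
  image psi (lasso r (model_point i)).

(** ** Relations; [(a, b)] stands for [a = b] *)

Definition induced_relations (beta : C -> C) (x : nat -> path)
  : list (path * path) :=
  map (fun j => (image beta (x j), x j)) (List.seq 1 6).

Definition relations (x : nat -> path) : list (path * path) :=
  let x1 := x 1%nat in let x2 := x 2%nat in let x3 := x 3%nat in
  let x4 := x 4%nat in let x5 := x 5%nat in let x6 := x 6%nat in
  [ (x5 ** x4 ** x3 ** x2,  x2 ** x5 ** x4 ** x3);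
    (x2 ** x5 ** x4 ** x3,  x3 ** x2 ** x5 ** x4);
    (x4 ** x5 ** x4 ** x3 ** x2 ** x5,  x5 ** x4 ** x3 ** x2 ** x5 ** x4);
    (x1,  x5 ** x4 ** x5^-1);
    (x5,  x6) ]%path.

(* Main.v *)
(* A realization F_t of a motion identifies pi_1 of the disk minus the points at
   time t with pi_1 at time 0, through the pull-back by F_t^-1 (which is jointly
   continuous in t).  The pull-back of a fixed loop does not change its class as
   long as the moving points stay away from the loop.  So the action of a motion
   is found by cutting the time interval into pieces, choosing on each piece
   polygonal loops avoiding the regions swept by the points, and rewriting at the
   cutting times the old loops as words in the new ones.  The homotopies between
   polygons are found by deleting, one after the other, the vertices that form
   with their two neighbours a triangle containing no puncture; this is decided
   by computation with integers.

   For the motion defining the g-base a single system of polygons avoids the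
   whole motion.  Over x = exp(2 i pi t) the fiber consists of 0, the four points
   i^n w and - w^2 / 2, where w = exp(i pi t), and four pieces suffice.  The
   result is
     x1 -> x5 x4 x5^-1,  x2 -> A x2 A^-1,  x3 -> (A x2) x3 (A x2)^-1,
     x4 -> (A x2) x1 (A x2)^-1,  x5 -> x6,
     x6 -> (x6 A x2 x1) x5 (x6 A x2 x1)^-1      with A = x5 x4 x3,
   and the two sets of relations are derived from each other in the free
   group. *)
Require Import Defs.
From Stdlib Require Import Reals ZArith List Lra Lia Psatz Bool.
From Stdlib Require Import FunctionalExtensionality ClassicalEpsilon.
From Coquelicot Require Import Coquelicot.
Import ListNotations.

Set Bullet Behavior "Strict Subproofs".

Open Scope bool_scope.
Open Scope lazy_bool_scope.
Open Scope R_scope.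

(** * Paths and homotopies *)

(** [psi] and [beta] come from arbitrary realizations, so nothing may depend on a choice of
    diffeomorphisms. All that is used of [F t] is where it sends the punctures, that it fixes the
    boundary (hence the base point), and that its inverse depends continuously on time and point
    together. This last fact is not part of [realizes]; compactness supplies it. The labelling of
    the monodromy motion is arbitrary too, so the proof follows the set of punctures over each [x]
    and asks only for triangles with integer corners that contain this set during a whole piece. A
    polygon is certified by separating its edges from these triangles by lines with small integer
    normals; the irrational positions of the points then enter only through a few inequalities
    between cosines and sines. Tracking expresses the generators at time 0 in the pull-backs of the
    generators by [G 1]; applying [F 1] turns this into the action of the monodromy, since [F 1]
    undoes [G 1]. *)

Lemma continuous_on_comp {T U V : UniformSpace} (D : T -> Prop) (E : U -> Prop)
    (f : T -> U) (g : U -> V) :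
  continuous_on D f -> (forall x, D x -> E (f x)) -> continuous_on E g ->
  continuous_on D (fun x => g (f x)).
Proof.
intros Hf HE Hg x Dx P HP.
specialize (Hg (f x) (HE x Dx) P HP).
specialize (Hf x Dx _ Hg).
unfold filtermap, within in *.
apply filter_imp with (2 := Hf); auto.
Qed.

Lemma continuous_on_pair {T U V : UniformSpace} (D : T -> Prop)
    (f : T -> U) (g : T -> V) :
  continuous_on D f -> continuous_on D g ->
  continuous_on D (fun x => (f x, g x)).
Proof.
intros Hf Hg x Dx.
apply filterlim_locally; intros eps.
pose proof (proj1 (filterlim_locally _ _) (Hf x Dx) eps) as H1.
pose proof (proj1 (filterlim_locally _ _) (Hg x Dx) eps) as H2.
apply filter_imp with (2 := filter_and _ _ H1 H2).
intros y [Hy1 Hy2]; split; assumption.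
Qed.

Lemma continuous_pair {T U V : UniformSpace} (f : T -> U) (g : T -> V) (x : T) :
  continuous f x -> continuous g x -> continuous (fun y => (f y, g y)) x.
Proof.
intros Hf Hg.
apply filterlim_locally; intros eps.
pose proof (proj1 (filterlim_locally _ _) Hf eps) as H1.
pose proof (proj1 (filterlim_locally _ _) Hg eps) as H2.
apply filter_imp with (2 := filter_and _ _ H1 H2).
intros y [Hy1 Hy2]; split; assumption.
Qed.

Lemma continuous_Rplus {T : UniformSpace} (f g : T -> R) (x : T) :
  continuous f x -> continuous g x -> continuous (fun y => f y + g y) x.
Proof. exact (continuous_plus (K := R_AbsRing) (V := R_NormedModule) f g x). Qed.

Lemma continuous_Ropp {T : UniformSpace} (f : T -> R) (x : T) :
  continuous f x -> continuous (fun y => - f y) x.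
Proof. exact (continuous_opp (K := R_AbsRing) (V := R_NormedModule) f x). Qed.

Lemma continuous_Rminus {T : UniformSpace} (f g : T -> R) (x : T) :
  continuous f x -> continuous g x -> continuous (fun y => f y - g y) x.
Proof. exact (continuous_minus (K := R_AbsRing) (V := R_NormedModule) f g x). Qed.

Lemma continuous_Rmult {T : UniformSpace} (f g : T -> R) (x : T) :
  continuous f x -> continuous g x -> continuous (fun y => f y * g y) x.
Proof. exact (continuous_mult (K := R_AbsRing) f g x). Qed.

Lemma continuous_Rmin {T : UniformSpace} (f g : T -> R) (x : T) :
  continuous f x -> continuous g x -> continuous (fun y => Rmin (f y) (g y)) x.
Proof.
intros Hf Hg.
apply continuous_ext with (fun y => / 2 * (f y + g y - Rabs (f y - g y))).
- intros y; unfold Rmin, Rabs; destruct (Rle_dec _ _), (Rcase_abs _); lra.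
- apply continuous_Rmult; [apply continuous_const|].
  apply continuous_Rminus; [now apply continuous_Rplus|].
  apply (continuous_comp (fun y => f y - g y) Rabs); [|apply continuous_Rabs].
  now apply continuous_Rminus.
Qed.

Lemma continuous_Rmax {T : UniformSpace} (f g : T -> R) (x : T) :
  continuous f x -> continuous g x -> continuous (fun y => Rmax (f y) (g y)) x.
Proof.
intros Hf Hg.
apply continuous_ext with (fun y => - Rmin (- f y) (- g y)).
- intros y; unfold Rmin, Rmax; destruct (Rle_dec _ _), (Rle_dec _ _); lra.
- apply continuous_Ropp, continuous_Rmin; now apply continuous_Ropp.
Qed.

Lemma continuous_fst_comp {T U V : UniformSpace} (f : T -> U * V) (x : T) :
  continuous f x -> continuous (fun y => fst (f y)) x.
Proof.
intros Hf.
apply filterlim_locally; intros eps.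
apply filter_imp with (2 := proj1 (filterlim_locally _ _) Hf eps).
now intros y [H _].
Qed.

Lemma continuous_snd_comp {T U V : UniformSpace} (f : T -> U * V) (x : T) :
  continuous f x -> continuous (fun y => snd (f y)) x.
Proof.
intros Hf.
apply filterlim_locally; intros eps.
apply filter_imp with (2 := proj1 (filterlim_locally _ _) Hf eps).
now intros y [_ H].
Qed.

Lemma continuous_C {T : UniformSpace} (f : T -> C) (x : T) :
  continuous (fun y => fst (f y) : R) x -> continuous (fun y => snd (f y) : R) x ->
  continuous f x.
Proof.
intros H1 H2.
apply (continuous_ext (fun y => (fst (f y), snd (f y)) : C)).
- intros y; now destruct (f y).
- exact (continuous_pair _ _ _ H1 H2).
Qed.

Ltac cont :=
  match goal with
  | |- continuous (fun _ => ?c) _ => apply continuous_const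
  | |- continuous (fun z => z) _ => apply continuous_id
  | |- continuous (Rmult ?c) _ =>
      apply (continuous_Rmult (fun _ => c) (fun z => z)); cont
  | |- continuous (Rplus ?c) _ =>
      apply (continuous_Rplus (fun _ => c) (fun z => z)); cont
  | |- continuous (Rminus ?c) _ =>
      apply (continuous_Rminus (fun _ => c) (fun z => z)); cont
  | |- continuous (pair ?c) _ =>
      apply (continuous_pair (fun _ => c) (fun z => z)); cont
  | |- continuous fst _ => apply continuous_fst_comp, continuous_id
  | |- continuous snd _ => apply continuous_snd_comp, continuous_id
  | H : forall p, continuous ?f p |- continuous ?f _ => apply H
  | |- continuous (fun _ => Rplus _ _) _ =>
      apply continuous_Rplus; cont
  | |- continuous (fun _ => Rminus _ _) _ =>
      apply continuous_Rminus; cont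
  | |- continuous (fun _ => Ropp _) _ =>
      apply continuous_Ropp; cont
  | |- continuous (fun _ => Rmult _ _) _ =>
      apply continuous_Rmult; cont
  | |- continuous (fun _ => Rmin _ _) _ => apply continuous_Rmin; cont
  | |- continuous (fun _ => Rmax _ _) _ => apply continuous_Rmax; cont
  | |- continuous (fun _ => cos _) _ =>
      apply (continuous_comp _ cos); [cont | apply continuous_cos]
  | |- continuous (fun _ => sin _) _ =>
      apply (continuous_comp _ sin); [cont | apply continuous_sin]
  | |- continuous (fun _ => (_, _)) _ => apply continuous_pair; cont
  | H : forall p, continuous ?f p |- continuous (fun _ => ?f _) _ =>
      apply (continuous_comp _ f); [cont | apply H]
  | |- continuous (fun _ => fst _) _ => apply continuous_fst_comp; cont
  | |- continuous (fun _ => snd _) _ => apply continuous_snd_comp; cont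
  | _ => idtac
  end.

Definition clamp (s : R) : R := Rmax 0 (Rmin s 1).

Lemma clamp_I01 s : I01 (clamp s).
Proof.
unfold I01, clamp, Rmax, Rmin; repeat destruct (Rle_dec _ _); lra.
Qed.

Lemma clamp_id s : I01 s -> clamp s = s.
Proof.
unfold I01, clamp, Rmax, Rmin; intros; repeat destruct (Rle_dec _ _); lra.
Qed.

Lemma continuous_clamp s : continuous clamp s.
Proof. unfold clamp; cont. Qed.

Definition square (p : R * R) : Prop := I01 (fst p) /\ I01 (snd p).

(* Maps continuous on the whole plane are glued by adding and subtracting, without
   case distinctions; precomposing with the retraction onto the square gives
   such maps. *)
Lemma extend_path (a : path) :
  continuous_on I01 a ->
  exists a' : path, (forall s, continuous a' s) /\ forall s, I01 s -> a' s = a s.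
Proof.
intros Ha; exists (fun s => a (clamp s)); split.
- intros s.
  apply (continuous_continuous_on (fun _ => True)); [now apply filter_true|].
  apply (continuous_on_comp _ I01); [|intros; apply clamp_I01|exact Ha].
  apply continuous_on_forall; intros; apply continuous_clamp.
- intros s Hs; now rewrite clamp_id.
Qed.

Lemma extend_homotopy (H : R * R -> C) :
  continuous_on square H ->
  exists H' : R * R -> C, (forall p, continuous H' p) /\
    forall p, square p -> H' p = H p.
Proof.
intros Ha; exists (fun p => H (clamp (fst p), clamp (snd p))); split.
- intros p.
  apply (continuous_continuous_on (fun _ => True)); [now apply filter_true|].
  apply (continuous_on_comp _ square); [|intros; split; apply clamp_I01|exact Ha].
  apply continuous_on_forall; intros q _.
  pose proof continuous_clamp; cont.
- intros [t s] [Ht Hs]; simpl in *; now rewrite !clamp_id.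
Qed.

(** Distinct endpoints are needed for the edges of polygons. For [u = v], [path_in] and [hom] unfold
    to [is_loop] and [homotopic], so results pass between them by conversion. *)
Definition path_in (X : C -> Prop) (u v : C) (a : path) : Prop :=
  continuous_on I01 a /\ (forall s, I01 s -> X (a s)) /\ a 0 = u /\ a 1 = v.

Definition hom (X : C -> Prop) (u v : C) (a b : path) : Prop :=
  exists H : R * R -> C,
    continuous_on (fun p => I01 (fst p) /\ I01 (snd p)) H /\
    (forall t s, I01 t -> I01 s -> X (H (t, s))) /\
    (forall s, I01 s -> H (0, s) = a s /\ H (1, s) = b s) /\
    (forall t, I01 t -> H (t, 0) = u /\ H (t, 1) = v).

Lemma hom_intro X u v a b (H : R * R -> C) :
  (forall p, continuous H p) ->
  (forall t s, I01 t -> I01 s -> X (H (t, s))) ->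
  (forall s, I01 s -> H (0, s) = a s /\ H (1, s) = b s) ->
  (forall t, I01 t -> H (t, 0) = u /\ H (t, 1) = v) ->
  hom X u v a b.
Proof.
intros HC HX H1 H2; exists H; split; [|now auto].
now apply continuous_on_forall; intros.
Qed.

Lemma hom_elim X u v a b :
  hom X u v a b ->
  exists H : R * R -> C,
  (forall p, continuous H p) /\
  (forall t s, I01 t -> I01 s -> X (H (t, s))) /\
  (forall s, I01 s -> H (0, s) = a s /\ H (1, s) = b s) /\
  (forall t, I01 t -> H (t, 0) = u /\ H (t, 1) = v).
Proof.
intros (H & HC & HX & H1 & H2).
destruct (extend_homotopy H HC) as (H' & HC' & E).
exists H'; split; [exact HC'|].
assert (I0 : I01 0) by (unfold I01; lra).
assert (I1 : I01 1) by (unfold I01; lra).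
split; [|split]; intros.
- rewrite E by (now split); now apply HX.
- rewrite !E by (now split); now apply H1.
- rewrite !E by (now split); now apply H2.
Qed.

Lemma I01_0 : I01 0. Proof. unfold I01; lra. Qed.
Lemma I01_1 : I01 1. Proof. unfold I01; lra. Qed.

Lemma hom_refl X u v a : path_in X u v a -> hom X u v a a.
Proof.
intros (HC & HX & H0 & H1).
destruct (extend_path a HC) as (a' & HC' & E).
apply hom_intro with (fun p => a' (snd p)).
- intros p; cont.
- intros t s Ht Hs; simpl; rewrite E; auto.
- intros s Hs; simpl; rewrite E; auto.
- intros t Ht; simpl; rewrite !E; auto using I01_0, I01_1.
Qed.

Lemma hom_ext X u v a b a' b' :
  hom X u v a b -> (forall s, I01 s -> a s = a' s) ->
  (forall s, I01 s -> b s = b' s) -> hom X u v a' b'.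
Proof.
intros (H & HC & HX & H1 & H2) Ea Eb; exists H; repeat split; auto;
try (apply H2; assumption).
- rewrite <- Ea by auto; now apply H1.
- rewrite <- Eb by auto; now apply H1.
Qed.

Lemma hom_sym X u v a b : hom X u v a b -> hom X u v b a.
Proof.
intros (H & HC & HX & H1 & H2)%hom_elim.
assert (HI : forall t, I01 t -> I01 (1 - t)) by (unfold I01; intros; lra).
apply hom_intro with (fun p => H (1 - fst p, snd p)).
- intros p; cont.
- intros t s Ht Hs; simpl; apply HX; auto.
- intros s Hs; simpl.
  replace (1 - 0) with 1 by ring; replace (1 - 1) with 0 by ring.
  destruct (H1 s Hs); auto.
- intros t Ht; simpl; apply H2; auto.
Qed.

Lemma hom_trans X u v a b c : hom X u v a b -> hom X u v b c -> hom X u v a c.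
Proof.
intros (H & HC & HX & H1 & H2)%hom_elim (K & KC & KX & K1 & K2)%hom_elim.
(* On either half one of the two moving terms rests at the common middle path, which the last term
   cancels. *)
assert (E : forall t s, I01 t -> I01 s ->
  (H (Rmin (2 * t) 1, s) + K (Rmax (2 * t - 1) 0, s) - K (0, s))%C =
  if Rle_dec t (/ 2) then H (2 * t, s) else K (2 * t - 1, s)).
{ intros t s Ht Hs; unfold I01 in Ht; destruct (Rle_dec t (/ 2)).
  - rewrite Rmin_left, Rmax_right by lra; ring.
  - rewrite Rmin_right, Rmax_left by lra.
    rewrite (proj2 (H1 s Hs)), (proj1 (K1 s Hs)); ring. }
apply hom_intro with (fun p =>
  (H (Rmin (2 * fst p) 1, snd p) + K (Rmax (2 * fst p - 1) 0, snd p) - K (0, snd p))%C).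
- intros p; apply continuous_C; simpl; cont.
- intros t s Ht Hs; simpl; rewrite E by auto; unfold I01 in Ht; destruct (Rle_dec t (/ 2)).
  + apply HX; [unfold I01; lra|auto].
  + apply KX; [unfold I01; lra|auto].
- intros s Hs; simpl; rewrite !E by auto using I01_0, I01_1.
  destruct (Rle_dec 0 (/ 2)) as [_|?]; [|lra].
  destruct (Rle_dec 1 (/ 2)) as [?|_]; [lra|].
  replace (2 * 0) with 0 by ring; replace (2 * 1 - 1) with 1 by ring.
  split; [now apply H1|now apply K1].
- intros t Ht; simpl; rewrite !E by auto using I01_0, I01_1.
  unfold I01 in Ht.
  destruct (Rle_dec t (/ 2)); [apply H2|apply K2]; unfold I01; lra.
Qed.

Lemma hom_mul X u v w a a' b b' :
  hom X u v a a' -> hom X v w b b' -> hom X u w (path_mul a b) (path_mul a' b').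
Proof.
intros (H & HC & HX & H1 & H2)%hom_elim (K & KC & KX & K1 & K2)%hom_elim.
assert (E : forall t s, I01 t -> I01 s ->
  (H (t, Rmin (2 * s) 1) + K (t, Rmax (2 * s - 1) 0) - v)%C =
  if Rle_dec s (1 / 2) then H (t, 2 * s) else K (t, 2 * s - 1)).
{ intros t s Ht Hs; unfold I01 in Hs; destruct (Rle_dec s (1 / 2)).
  - rewrite Rmin_left, Rmax_right by lra.
    rewrite (proj1 (K2 t Ht)); ring.
  - rewrite Rmin_right, Rmax_left by lra.
    rewrite (proj2 (H2 t Ht)); ring. }
apply hom_intro with (fun p =>
  (H (fst p, Rmin (2 * snd p) 1) + K (fst p, Rmax (2 * snd p - 1) 0) - v)%C).
- intros p; apply continuous_C; simpl; cont.
- intros t s Ht Hs; simpl; rewrite E by auto; unfold I01 in Hs; destruct (Rle_dec s (1 / 2)).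
  + apply HX; [auto|unfold I01; lra].
  + apply KX; [auto|unfold I01; lra].
- intros s Hs; simpl; rewrite !E by auto using I01_0, I01_1.
  unfold path_mul; unfold I01 in Hs.
  destruct (Rle_dec s (1 / 2)); [apply H1|apply K1]; unfold I01; lra.
- intros t Ht; simpl; rewrite !E by auto using I01_0, I01_1.
  destruct (Rle_dec 0 (1 / 2)) as [_|?]; [|lra].
  destruct (Rle_dec 1 (1 / 2)) as [?|_]; [lra|].
  replace (2 * 0) with 0 by ring; replace (2 * 1 - 1) with 1 by ring.
  split; [now apply H2|now apply K2].
Qed.

Lemma hom_inv X u v a b : hom X u v a b -> hom X v u (path_inv a) (path_inv b).
Proof.
intros (H & HC & HX & H1 & H2)%hom_elim.
assert (HI : forall t, I01 t -> I01 (1 - t)) by (unfold I01; intros; lra).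
apply hom_intro with (fun p => H (fst p, 1 - snd p)).
- intros p; cont.
- intros t s Ht Hs; simpl; apply HX; auto.
- intros s Hs; simpl; apply (H1 (1 - s)); auto.
- intros t Ht; simpl.
  replace (1 - 0) with 1 by ring; replace (1 - 1) with 0 by ring.
  split; now apply H2.
Qed.

Lemma hom_path_l X u v a b : hom X u v a b -> path_in X u v a.
Proof.
intros (H & HC & HX & H1 & H2)%hom_elim.
repeat split.
- apply continuous_on_ext with (fun s => H (0, s)).
  + intros s Hs; now apply H1.
  + apply continuous_on_forall; intros; cont.
- intros s Hs; rewrite <- (proj1 (H1 s Hs)); apply HX; auto using I01_0.
- rewrite <- (proj1 (H1 0 I01_0)); apply H2, I01_0.
- rewrite <- (proj1 (H1 1 I01_1)); apply H2, I01_0.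
Qed.

Lemma hom_path_r X u v a b : hom X u v a b -> path_in X u v b.
Proof. intros H%hom_sym; now apply hom_path_l in H. Qed.

Lemma path_in_mul X u v w a b :
  path_in X u v a -> path_in X v w b -> path_in X u w (path_mul a b).
Proof. intros Ha Hb; eapply hom_path_l, hom_mul; apply hom_refl; eassumption. Qed.

Lemma path_in_inv X u v a : path_in X u v a -> path_in X v u (path_inv a).
Proof. intros Ha; eapply hom_path_l, hom_inv; apply hom_refl; eassumption. Qed.

Lemma path_in_const (X : C -> Prop) u : X u -> path_in X u u (fun _ => u).
Proof.
intros Hu; repeat split; auto; apply continuous_on_forall; intros; cont.
Qed.

(** The unit interval is convex, so the parameters [f] and [g] can be interpolated linearly without
    leaving the image of [c]. Associativity, units and inverses all come from this. *)
Lemma hom_reparam X u v (c a b : path) (f g : R -> R) :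
  continuous_on I01 c -> (forall s, I01 s -> X (c s)) ->
  (forall s, continuous f s) -> (forall s, continuous g s) ->
  (forall s, I01 s -> I01 (f s)) -> (forall s, I01 s -> I01 (g s)) ->
  f 0 = g 0 -> f 1 = g 1 -> c (f 0) = u -> c (f 1) = v ->
  (forall s, I01 s -> a s = c (f s)) -> (forall s, I01 s -> b s = c (g s)) ->
  hom X u v a b.
Proof.
intros Hc HX Hf Hg If Ig E0 E1 U V Ea Eb.
destruct (extend_path c Hc) as (c' & HC' & E).
assert (II : forall t s, I01 t -> I01 s -> I01 ((1 - t) * f s + t * g s)).
{ intros t s Ht Hs; generalize (If s Hs) (Ig s Hs); unfold I01 in *; intros; nra. }
apply hom_intro with (fun p => c' ((1 - fst p) * f (snd p) + fst p * g (snd p))).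
- intros p; cont.
- intros t s Ht Hs; simpl; rewrite E; auto.
- intros s Hs; simpl; rewrite Ea, Eb by auto; rewrite <- !E by auto.
  split; f_equal; ring.
- intros t Ht; simpl; rewrite <- E0, <- E1, <- U, <- V.
  rewrite <- !E by auto using I01_0, I01_1.
  split; f_equal; ring.
Qed.

Lemma path_mul_0 a b : path_mul a b 0 = a 0.
Proof. unfold path_mul; destruct (Rle_dec 0 (1 / 2)); [f_equal; ring|lra]. Qed.

Lemma path_mul_1 a b : path_mul a b 1 = b 1.
Proof. unfold path_mul; destruct (Rle_dec 1 (1 / 2)); [lra|f_equal; ring]. Qed.

Lemma hom_assoc X u v w x a b c :
  path_in X u v a -> path_in X v w b -> path_in X w x c ->
  hom X u x (path_mul (path_mul a b) c) (path_mul a (path_mul b c)).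
Proof.
intros Ha Hb Hc.
assert (HA := path_in_mul _ _ _ _ _ _ Ha (path_in_mul _ _ _ _ _ _ Hb Hc)).
destruct HA as (H1 & H2 & H3 & H4).
(* The change of parameter carries the breakpoints 1/4 and 1/2 of the left side to 1/2 and 3/4. Its
   slopes 2, 1, 1/2 decrease, so it is a minimum of three affine maps. *)
apply hom_reparam with (c := path_mul a (path_mul b c))
  (f := fun s => Rmin (2 * s) (Rmin (s + / 4) (s / 2 + / 2))) (g := fun s => s); auto;
try (now intros; unfold Rdiv; cont).
- unfold I01, Rmin; intros; repeat destruct (Rle_dec _ _); lra.
- unfold I01, Rmin; intros; repeat destruct (Rle_dec _ _); lra.
- unfold I01, Rmin; intros; repeat destruct (Rle_dec _ _); lra.
- match goal with |- _ ?t = _ => replace t with 0; [exact H3|] end.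
  unfold I01, Rmin; intros; repeat destruct (Rle_dec _ _); lra.
- match goal with |- _ ?t = _ => replace t with 1; [exact H4|] end.
  unfold I01, Rmin; intros; repeat destruct (Rle_dec _ _); lra.
- intros s Hs; unfold I01 in Hs.
  destruct (Rle_dec s (1 / 4)) as [L|L]; [|destruct (Rle_dec s (1 / 2)) as [L'|L']].
  + rewrite !Rmin_left by (try apply Rmin_glb; lra).
    unfold path_mul.
    destruct (Rle_dec s (1 / 2)); [|lra].
    destruct (Rle_dec (2 * s) (1 / 2)); [|lra].
    reflexivity.
  + rewrite (Rmin_left (s + / 4)), Rmin_right by lra.
    unfold path_mul.
    destruct (Rle_dec s (1 / 2)); [|lra].
    destruct (Rle_dec (2 * s) (1 / 2)); [lra|].
    destruct (Rle_dec (s + / 4) (1 / 2)); [lra|].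
    destruct (Rle_dec (2 * (s + / 4) - 1) (1 / 2)); [|lra].
    f_equal; field.
  + rewrite (Rmin_right (s + / 4)), Rmin_right by lra.
    unfold path_mul.
    destruct (Rle_dec s (1 / 2)); [lra|].
    destruct (Rle_dec (s / 2 + / 2) (1 / 2)); [lra|].
    destruct (Rle_dec (2 * (s / 2 + / 2) - 1) (1 / 2)); [lra|].
    f_equal; field.
Qed.

Lemma hom_1l X u v a : path_in X u v a -> hom X u v (path_mul (fun _ => u) a) a.
Proof.
intros (H1 & H2 & H3 & H4).
apply hom_reparam with (c := a) (f := fun s => Rmax (2 * s - 1) 0) (g := fun s => s); auto;
try (now intros; unfold Rdiv; cont);
try (unfold I01, Rmax; intros; repeat destruct (Rle_dec _ _); lra).
- rewrite Rmax_right by lra; auto.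
- rewrite Rmax_left by lra; rewrite <- H4; f_equal; ring.
- intros s Hs; unfold path_mul.
  destruct (Rle_dec s (1 / 2)).
  + rewrite Rmax_right by lra; auto.
  + rewrite Rmax_left by lra; auto.
Qed.

Lemma hom_1r X u v a : path_in X u v a -> hom X u v (path_mul a (fun _ => v)) a.
Proof.
intros (H1 & H2 & H3 & H4).
apply hom_reparam with (c := a) (f := fun s => Rmin (2 * s) 1) (g := fun s => s); auto;
try (now intros; unfold Rdiv; cont);
try (unfold I01, Rmin; intros; repeat destruct (Rle_dec _ _); lra).
- rewrite Rmin_left by lra; rewrite <- H3; f_equal; ring.
- rewrite Rmin_right by lra; auto.
- intros s Hs; unfold path_mul.
  destruct (Rle_dec s (1 / 2)).
  + rewrite Rmin_left by lra; auto.
  + rewrite Rmin_right by lra; auto.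
Qed.

Lemma hom_inv_r X u v a :
  path_in X u v a -> hom X u u (path_mul a (path_inv a)) (fun _ => u).
Proof.
intros (H1 & H2 & H3 & H4).
(* The tent function runs along [a] and back; it is deformed to the constant parameter 0. *)
apply hom_reparam with (c := a) (f := fun s => Rmin (2 * s) (2 - 2 * s)) (g := fun s => 0); auto;
try (now intros; unfold Rdiv; cont);
try (unfold I01, Rmin; intros; repeat destruct (Rle_dec _ _); lra).
- rewrite Rmin_left by lra; rewrite <- H3; f_equal; ring.
- rewrite Rmin_right by lra; rewrite <- H3; f_equal; ring.
- intros s Hs; unfold path_mul, path_inv.
  destruct (Rle_dec s (1 / 2)).
  + rewrite Rmin_left by lra; auto.
  + rewrite Rmin_right by lra; f_equal; ring.
Qed.

Lemma path_inv_inv a : path_inv (path_inv a) = a.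
Proof.
apply functional_extensionality; intros s; unfold path_inv; f_equal; ring.
Qed.

Lemma hom_inv_l X u v a :
  path_in X u v a -> hom X v v (path_mul (path_inv a) a) (fun _ => v).
Proof.
intros Ha%path_in_inv.
apply hom_inv_r in Ha; now rewrite path_inv_inv in Ha.
Qed.

Lemma hom_image (X Y : C -> Prop) u v a b (f : C -> C) :
  continuous_on X f -> (forall z, X z -> Y (f z)) ->
  hom X u v a b -> hom Y (f u) (f v) (image f a) (image f b).
Proof.
intros Hf HY (H & HC & HX & H1 & H2).
exists (fun p => f (H p)); repeat split.
- apply (continuous_on_comp _ X); auto.
  intros [t s] [Ht Hs]; now apply HX.
- intros; now apply HY, HX.
- unfold image; f_equal; now apply H1.
- unfold image; f_equal; now apply H1.
- f_equal; now apply H2.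
- f_equal; now apply H2.
Qed.

Lemma image_mul f a b : image f (path_mul a b) = path_mul (image f a) (image f b).
Proof.
apply functional_extensionality; intros s; unfold image, path_mul.
now destruct (Rle_dec s (1 / 2)).
Qed.

Lemma hom_straight (X : C -> Prop) u v a b :
  path_in X u v a -> path_in X u v b ->
  (forall t s, I01 t -> I01 s -> X ((1 - t) * a s + t * b s)%C) ->
  hom X u v a b.
Proof.
intros (A1 & A2 & A3 & A4) (B1 & B2 & B3 & B4) HX.
destruct (extend_path a A1) as (a' & CA & EA).
destruct (extend_path b B1) as (b' & CB & EB).
apply hom_intro with (fun p : R * R =>
  ((1 - RtoC (fst p)) * a' (snd p) + RtoC (fst p) * b' (snd p))%C).
- intros p; apply continuous_C; simpl; cont.
- intros t s Ht Hs; simpl; rewrite EA, EB by auto.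
  now apply HX.
- intros s Hs; simpl; rewrite EA, EB by auto; split; ring.
- intros t Ht; simpl; rewrite !EA, !EB by auto using I01_0, I01_1.
  rewrite A3, A4, B3, B4; split; ring.
Qed.

(** * Transport of loops by an isotopy of the disk *)

Lemma disk_closed (w : C) :
  ~ disk w -> exists d : posreal, forall w' : C, ball w d w' -> ~ disk w'.
Proof.
unfold disk; intros Hw.
(* Balls of the product are squares: the modulus is at most [sqrt 2] times the larger coordinate,
   and half the gap suffices because [sqrt 2 < 2]. *)
assert (P : 0 < (Cmod w - 4) / 2) by lra.
exists (mkposreal _ P); intros w' [B1 B2] Hw'; simpl in B1, B2.
change (Rabs (fst w' - fst w) < (Cmod w - 4) / 2) in B1.
change (Rabs (snd w' - snd w) < (Cmod w - 4) / 2) in B2.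
assert (T := Cmod_triangle w' (w - w')%C).
replace (w' + (w - w'))%C with w in T by ring.
assert (U := Cmod_2Rmax (w - w')%C); simpl in U.
assert (V : Rmax (Rabs (fst w + - fst w')) (Rabs (snd w + - snd w')) <= (Cmod w - 4) / 2).
{ replace (fst w + - fst w') with (- (fst w' - fst w)) by ring.
  replace (snd w + - snd w') with (- (snd w' - snd w)) by ring.
  rewrite !Rabs_Ropp; apply Rmax_lub; lra. }
assert (S : sqrt 2 < 2).
{ rewrite <- (sqrt_square 2) at 2 by lra; apply sqrt_lt_1; lra. }
assert (0 <= sqrt 2) by apply sqrt_pos.
assert (sqrt 2 * Rmax (Rabs (fst w + - fst w')) (Rabs (snd w + - snd w')) <=
  sqrt 2 * ((Cmod w - 4) / 2)) by (apply Rmult_le_compat_l; assumption).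
nra.
Qed.

Lemma disk_coords (w : C) : disk w -> -4 <= fst w <= 4 /\ -4 <= snd w <= 4.
Proof.
unfold disk; intros Hw.
assert (H := Rmax_Cmod w).
assert (H1 := Rmax_l (Rabs (fst w)) (Rabs (snd w))).
assert (H2 := Rmax_r (Rabs (fst w)) (Rabs (snd w))).
split; apply Rabs_le_between; lra.
Qed.

Definition cylinder (p : R * C) : Prop := I01 (fst p) /\ disk (snd p).

(* By compactness, as for a continuous bijection between compact spaces. *)
Lemma inverse_family_continuous (F G : R -> C -> C) :
  continuous_on cylinder (fun p : R * C => F (fst p) (snd p)) ->
  (forall t z, I01 t -> disk z -> disk (G t z)) ->
  (forall t z, I01 t -> disk z -> F t (G t z) = z) ->
  (forall t z, I01 t -> disk z -> G t (F t z) = z) ->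
  continuous_on cylinder (fun p : R * C => G (fst p) (snd p)).
Proof.
intros CF DG FG GF [t0 z0] [It0 Dz0]; simpl in It0, Dz0.
apply filterlim_locally; intros eps; simpl.
(* [Q w d]: for [(t, z)] near [(t0, z0)], any preimage of [z] under [F t] found near [w] is close to
   [G t0 z0]. For [w] outside the disk, or with [F t0 w] different from [z0], there is no such
   preimage once [d] is small. *)
set (Q := fun (w : C) (d : posreal) => forall t z w', I01 t -> disk w' ->
  ball t0 d t -> ball z0 d z -> ball w d w' -> F t w' = z ->
  ball (G t0 z0) eps w').
assert (HQ : forall w, exists d, Q w d).
{ intros w.
  destruct (classic (disk w)) as [Dw|Dw].
  2:{ destruct (disk_closed w Dw) as [d Hd]; exists d.
      intros t z w' It Dw' _ _ B _; elim (Hd w' B Dw'). }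
  destruct (classic (F t0 w = z0)) as [E|E].
  { exists eps; intros t z w' It Dw' _ _ B _.
    rewrite <- E, GF; auto. }
  assert (exists e : posreal, forall z, ball (F t0 w) e z -> ball z0 e z -> False)
    as [e He].
  { apply NNPP; intros N; apply E.
    apply (eq_close (F t0 w) z0); intros e.
    apply NNPP; intros N'; apply N.
    exists (pos_div_2 e); intros z B1 B2; apply N'.
    replace (pos e) with (e / 2 + e / 2) by field.
    eapply ball_triangle; [exact B1|apply ball_sym; exact B2]. }
  assert (L := proj1 (filterlim_locally _ _) (CF (t0, w) (conj It0 Dw)) e).
  destruct L as [d Hd]; simpl in Hd.
  assert (Pm : 0 < Rmin d e) by (apply Rmin_pos; apply cond_pos).
  exists (mkposreal _ Pm); intros t z w' It Dw' B1 B2 B3 EF; exfalso.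
  apply (He z).
  - rewrite <- EF; apply (Hd (t, w')); [|now split].
    split; [eapply ball_le; [|exact B1]|eapply ball_le; [|exact B3]];
    apply Rmin_l.
  - eapply ball_le; [|exact B2]; apply Rmin_r. }
(* The square of half-side 4 contains the disk, hence all values of [G]; one radius [d] then serves
   everywhere. The covering is delivered under a double negation, which the classical step below
   removes. *)
destruct (compactness_value_2d (-4) 4 (-4) 4
  (fun x y => proj1_sig (constructive_indefinite_description _ (HQ (x, y)))))
  as [d Hd].
exists d; intros [t z] [Bt Bz] [It Dz]; simpl in *.
destruct (disk_coords _ (DG t z It Dz)) as [X Y].
apply NNPP; intros N.
apply (Hd _ _ X Y); intros (x & y & Hx & Hy & Bx & By & Hle).
apply N.
destruct (constructive_indefinite_description _ (HQ (x, y))) as [e He]; simpl in *.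
apply (He t z (G t z)); auto.
- eapply ball_le; eassumption.
- eapply ball_le; eassumption.
- split; assumption.
Qed.

(** [punctured_disk] is [avoid K] by conversion. *)
Definition avoid (P : C -> Prop) (y : C) : Prop := disk y /\ ~ P y.

Definition moved (P : C -> Prop) (f : C -> C) (y : C) : Prop :=
  exists p, P p /\ f p = y.

Record isotopy (F G : R -> C -> C) : Prop := {
  iso_cont : continuous_on cylinder (fun p : R * C => F (fst p) (snd p));
  iso_inv_cont : continuous_on cylinder (fun p : R * C => G (fst p) (snd p));
  iso_disk : forall t z, I01 t -> disk z -> disk (F t z);
  iso_inv_disk : forall t z, I01 t -> disk z -> disk (G t z);
  iso_FG : forall t z, I01 t -> disk z -> F t (G t z) = z;
  iso_GF : forall t z, I01 t -> disk z -> G t (F t z) = z;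
  iso_0 : forall z, disk z -> F 0 z = z;
  iso_boundary : forall t z, I01 t -> Cmod z = 4 -> F t z = z }.

Lemma realizes_isotopy n m F : realizes n m F -> exists G, isotopy F G.
Proof.
intros (CF & HD & H0 & HB & _).
(* The choice of inverses ranges over all real [t]; outside the unit interval the identity is a
   default value. *)
assert (HG : forall t, exists g : C -> C, I01 t -> (forall z, disk z -> disk (g z)) /\
  (forall z, disk z -> g (F t z) = z /\ F t (g z) = z)).
{ intros t; destruct (classic (I01 t)) as [It|It].
  - destruct (HD t It) as (_ & _ & g & _ & Hg1 & Hg2); exists g; auto.
  - exists (fun z => z); intros; contradiction. }
set (G t := proj1_sig (constructive_indefinite_description _ (HG t))).
assert (PG : forall t, I01 t -> (forall z, disk z -> disk (G t z)) /\
  (forall z, disk z -> G t (F t z) = z /\ F t (G t z) = z)).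
{ intros t; unfold G; now destruct (constructive_indefinite_description _ _). }
exists G; split; auto.
- apply (inverse_family_continuous F); auto; intros; now apply PG.
- intros; now apply HD.
- intros; now apply PG.
- intros; now apply PG.
- intros; now apply PG.
Qed.

Section Transport.

Variables F G : R -> C -> C.
Hypothesis FG : isotopy F G.

Lemma iso_inv_0 z : disk z -> G 0 z = z.
Proof.
intros Hz; rewrite <- (iso_0 _ _ FG z Hz) at 1.
apply (iso_GF _ _ FG); auto using I01_0.
Qed.

Lemma boundary_disk z : Cmod z = 4 -> disk z.
Proof. unfold disk; lra. Qed.

Lemma iso_inv_boundary t z : I01 t -> Cmod z = 4 -> G t z = z.
Proof.
intros It Hz; rewrite <- (iso_boundary _ _ FG t z It Hz) at 1.
apply (iso_GF _ _ FG); auto using boundary_disk.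
Qed.

Lemma iso_slice t : I01 t -> continuous_on disk (F t).
Proof.
intros It; apply (continuous_on_comp disk cylinder (fun z => (t, z))
  (fun p => F (fst p) (snd p))).
- apply continuous_on_forall; intros; cont.
- now split.
- apply FG.
Qed.

Lemma iso_inv_slice t : I01 t -> continuous_on disk (G t).
Proof.
intros It; apply (continuous_on_comp disk cylinder (fun z => (t, z))
  (fun p => G (fst p) (snd p))).
- apply continuous_on_forall; intros; cont.
- now split.
- apply FG.
Qed.

Variables (P : C -> Prop) (u : C).
Hypotheses (Pdisk : forall p, P p -> disk p) (Hu : Cmod u = 4).

Lemma avoid_pull t z : I01 t -> avoid (moved P (F t)) z -> avoid P (G t z).
Proof.
intros It [Dz Hz]; split; [now apply FG|].
intros Hp; apply Hz; exists (G t z); split; auto; now apply FG.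
Qed.

Lemma avoid_push t z : I01 t -> avoid P z -> avoid (moved P (F t)) (F t z).
Proof.
intros It [Dz Hz]; split; [now apply FG|].
intros (p & Hp & E); apply Hz.
rewrite <- (iso_GF _ _ FG t z It Dz), <- E, (iso_GF _ _ FG); auto.
Qed.

Lemma transport_hom t a b :
  I01 t -> hom (avoid (moved P (F t))) u u a b ->
  hom (avoid P) u u (image (G t) a) (image (G t) b).
Proof.
intros It H.
rewrite <- (iso_inv_boundary t u It Hu).
apply (hom_image (avoid (moved P (F t)))); auto.
- apply (continuous_on_subset disk); [|now apply iso_inv_slice].
  now intros z [Dz _].
- intros; now apply avoid_pull.
Qed.

Lemma push_hom t a b :
  I01 t -> hom (avoid P) u u a b ->
  hom (avoid (moved P (F t))) u u (image (F t) a) (image (F t) b).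
Proof.
intros It H.
rewrite <- (iso_boundary _ _ FG t u It Hu).
apply (hom_image (avoid P)); auto.
- apply (continuous_on_subset disk); [|now apply iso_slice].
  now intros z [Dz _].
- intros; now apply avoid_push.
Qed.

(** The pull-backs at the intermediate times are themselves the homotopy; this is what the joint
    continuity of [G] is for. *)
Lemma transport_still t0 t1 a :
  I01 t0 -> I01 t1 -> t0 <= t1 ->
  (forall t, t0 <= t <= t1 -> path_in (avoid (moved P (F t))) u u a) ->
  hom (avoid P) u u (image (G t0) a) (image (G t1) a).
Proof.
intros I0 I1 L HA.
assert (IT : forall t, I01 t -> t0 <= t0 + t * (t1 - t0) <= t1)
  by (unfold I01; intros; nra).
assert (IT' : forall t, I01 t -> I01 (t0 + t * (t1 - t0)))
  by (intros t It; generalize (IT t It); unfold I01 in *; lra).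
destruct (HA t0 ltac:(lra)) as (Ca & _ & a0 & a1).
exists (fun p => G (t0 + fst p * (t1 - t0)) (a (snd p))); simpl; repeat split.
- apply (continuous_on_comp _ cylinder
    (fun p : R * R => (t0 + fst p * (t1 - t0), a (snd p))) (fun p => G (fst p) (snd p))).
  + apply continuous_on_pair.
    * apply continuous_on_forall; intros; cont.
    * apply (continuous_on_comp _ I01); [|now intros p [_ Hp]|exact Ca].
      apply continuous_on_forall; intros; cont.
  + intros p [It Is]; split; simpl; auto.
    now apply (HA t0 ltac:(lra)).
  + apply FG.
- apply avoid_pull; auto; now apply (HA _ (IT t H)).
- apply avoid_pull; auto; now apply (HA _ (IT t H)).
- unfold image; f_equal; ring.
- unfold image; f_equal; ring.
- rewrite a0; apply iso_inv_boundary; auto.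
- rewrite a1; apply iso_inv_boundary; auto.
Qed.

End Transport.

(** * Polygons *)

Definition vertex : Type := (Z * Z)%type.

(* Coordinates are in hundredths. *)
Definition vtx (v : vertex) : C := (IZR (fst v) / 100, IZR (snd v) / 100).

(* Nonempty lists are meant; the value at [nil] is junk. *)
Fixpoint polygon (l : list vertex) : path :=
  match l with
  | [] => fun _ => RtoC 0
  | [a] => fun _ => vtx a
  | a :: (b :: _) as l' => path_mul (segment (vtx a) (vtx b)) (polygon l')
  end.

Definition origin : vertex := (0, 0)%Z.

Definition first (l : list vertex) : vertex := hd origin l.

Definition final (l : list vertex) : vertex := last l origin.

Lemma final_cons a b l : final (a :: b :: l) = final (b :: l).
Proof. reflexivity. Qed.

Lemma final_app l a l' : final (l ++ a :: l') = final (a :: l').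
Proof.
induction l as [|b l IH]; [reflexivity|].
rewrite <- IH; destruct l; reflexivity.
Qed.

Lemma segment_0 a b : segment a b 0 = a.
Proof. unfold segment; ring. Qed.

Lemma segment_1 a b : segment a b 1 = b.
Proof. unfold segment; ring. Qed.

Lemma segment_inv a b : path_inv (segment a b) = segment b a.
Proof.
apply functional_extensionality; intros s; unfold path_inv, segment.
rewrite RtoC_minus; ring.
Qed.

Lemma segment_const a : segment a a = fun _ => a.
Proof. apply functional_extensionality; intros s; unfold segment; ring. Qed.

Definition combination (x y z : R) (a b c : vertex) : C :=
  (RtoC x * vtx a + RtoC y * vtx b + RtoC z * vtx c)%C.

Definition triangle_in (X : C -> Prop) (a b c : vertex) : Prop :=
  forall x y z, 0 <= x -> 0 <= y -> 0 <= z -> x + y + z = 1 ->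
  X (combination x y z a b c).

(** An edge is the degenerate triangle [a b b], so that a single clearance test serves edges and
    triangles. *)
Fixpoint edges_in (X : C -> Prop) (l : list vertex) : Prop :=
  match l with
  | [] => True
  | [a] => X (vtx a)
  | a :: (b :: _) as l' => triangle_in X a b b /\ edges_in X l'
  end.

Section Polygons.

Variable X : C -> Prop.

Lemma segment_path_in a b :
  triangle_in X a b b -> path_in X (vtx a) (vtx b) (segment (vtx a) (vtx b)).
Proof.
intros H; repeat split.
- apply continuous_on_forall; intros s _; apply continuous_C; simpl; cont.
- intros s [H0 H1].
  replace (segment (vtx a) (vtx b) s) with (combination (1 - s) s 0 a b b).
  + apply H; lra.
  + unfold combination, segment; rewrite RtoC_minus; ring.
- apply segment_0.
- apply segment_1.
Qed.

Lemma triangle_edges a b c :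
  triangle_in X a b c ->
  triangle_in X a b b /\ triangle_in X b c c /\ triangle_in X a c c.
Proof.
intros H; repeat split; intros x y z Hx Hy Hz E.
- replace (combination x y z a b b) with (combination x (y + z) 0 a b c)
    by (unfold combination; rewrite RtoC_plus; ring).
  apply H; lra.
- replace (combination x y z b c c) with (combination 0 x (y + z) a b c)
    by (unfold combination; rewrite RtoC_plus; ring).
  apply H; lra.
- replace (combination x y z a c c) with (combination x 0 (y + z) a b c)
    by (unfold combination; rewrite RtoC_plus; ring).
  apply H; lra.
Qed.

Lemma triangle_hom a b c :
  triangle_in X a b c ->
  hom X (vtx a) (vtx c)
    (path_mul (segment (vtx a) (vtx b)) (segment (vtx b) (vtx c)))
    (segment (vtx a) (vtx c)).
Proof.
intros H; destruct (triangle_edges a b c H) as (H1 & H2 & H3).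
apply hom_straight.
- eapply path_in_mul; apply segment_path_in; assumption.
- now apply segment_path_in.
- intros t s [Ht Ht'] [Hs Hs']; unfold path_mul.
  destruct (Rle_dec s (1 / 2)).
  (* The weights are barycentric coordinates of the point reached by the straight homotopy; they
     show that it never leaves the triangle. *)
  + match goal with |- X ?w => replace w with
      (combination ((1 - t) * (1 - 2 * s) + t * (1 - s)) ((1 - t) * (2 * s)) (t * s) a b c) end.
    * apply H; nra.
    * unfold combination, segment.
      rewrite !RtoC_plus, !RtoC_mult, !RtoC_minus, !RtoC_mult; ring.
  + match goal with |- X ?w => replace w with
      (combination (t * (1 - s)) ((1 - t) * (2 - 2 * s)) ((1 - t) * (2 * s - 1) + t * s) a b c) end.
    * apply H; nra.
    * unfold combination, segment.
      rewrite !RtoC_plus, !RtoC_mult, !RtoC_minus, !RtoC_mult; ring.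
Qed.

Lemma edges_in_tl a l : edges_in X (a :: l) -> edges_in X l.
Proof. destruct l; simpl; tauto. Qed.

Lemma polygon_path_in a l :
  edges_in X (a :: l) ->
  path_in X (vtx a) (vtx (final (a :: l))) (polygon (a :: l)).
Proof.
revert a; induction l as [|b l IH]; intros a H.
- now apply path_in_const.
- destruct H as [H1 H2]; rewrite final_cons.
  eapply path_in_mul; [now apply segment_path_in|now apply IH].
Qed.

Definition poly_hom (l l' : list vertex) : Prop :=
  first l = first l' /\ final l = final l' /\
  hom X (vtx (first l)) (vtx (final l)) (polygon l) (polygon l').

Lemma poly_hom_cons a l l' :
  l <> [] -> l' <> [] -> edges_in X (a :: l) -> poly_hom l l' ->
  poly_hom (a :: l) (a :: l').
Proof.
destruct l as [|b l]; [easy|]; destruct l' as [|b' l']; [easy|].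
intros _ _ [H1 _] (E1 & E2 & H); simpl in E1; subst b'.
repeat split; [exact E2|].
cbn [first hd]; rewrite final_cons.
eapply hom_mul; [|exact H].
now apply hom_refl, segment_path_in.
Qed.

Lemma edges_in_delete p a b c q :
  edges_in X (p ++ a :: b :: c :: q) -> triangle_in X a b c ->
  edges_in X (p ++ a :: c :: q).
Proof.
intros H HT; induction p as [|d p IH].
- destruct H as (_ & _ & H); split; [now apply (triangle_edges a b c)|exact H].
- cbn [app] in *; destruct p as [|e p]; cbn [app] in *.
  + split; [apply H|apply IH, H].
  + split; [apply H|apply IH, H].
Qed.

Lemma polygon_delete p a b c q :
  edges_in X (p ++ a :: b :: c :: q) -> triangle_in X a b c ->
  poly_hom (p ++ a :: b :: c :: q) (p ++ a :: c :: q).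
Proof.
intros H HT; induction p as [|d p IH].
- repeat split; cbn [app first hd].
  destruct H as (H1 & H2 & H3).
  rewrite !final_cons.
  assert (HP := polygon_path_in _ _ H3).
  apply hom_trans with (path_mul (path_mul (segment (vtx a) (vtx b)) (segment (vtx b) (vtx c))) (polygon (c :: q))).
  + apply hom_sym, (hom_assoc X _ (vtx b) (vtx c));
    [now apply segment_path_in|now apply segment_path_in|exact HP].
  + eapply hom_mul; [now apply triangle_hom|now apply hom_refl].
- apply poly_hom_cons; [now destruct p|now destruct p|exact H|].
  apply IH; now apply edges_in_tl in H.
Qed.

Lemma poly_hom_refl l : l <> [] -> edges_in X l -> poly_hom l l.
Proof.
destruct l as [|a l]; [easy|]; intros _ H; repeat split.
now apply hom_refl, polygon_path_in.
Qed.

Lemma poly_hom_trans l l' l'' : poly_hom l l' -> poly_hom l' l'' -> poly_hom l l''.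
Proof.
intros (E1 & E2 & H) (F1 & F2 & H'); repeat split; try congruence.
rewrite <- E1, <- E2 in H'; eapply hom_trans; eassumption.
Qed.

Variable clear : vertex -> vertex -> vertex -> bool.

Hypothesis clear_sound : forall a b c, clear a b c = true -> triangle_in X a b c.

(** The stack holds the vertices kept so far, latest first. As in the free reduction of a word, a
    new vertex removes the top one as long as their triangle with the next one is clear, since each
    deletion may make another possible. *)
Fixpoint push (st : list vertex) (v : vertex) : list vertex :=
  match st with
  | b :: ((a :: _) as st') => if clear a b v then push st' v else v :: st
  | _ => v :: st
  end.

Definition contract (l : list vertex) : list vertex := rev (fold_left push l []).

Fixpoint edges_clear (l : list vertex) : bool :=
  match l with
  | [] => true
  | [a] => clear a a a
  | a :: (b :: _) as l' => clear a b b && edges_clear l'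
  end.

Lemma edges_clear_sound l : edges_clear l = true -> edges_in X l.
Proof.
induction l as [|a [|b l] IH]; [easy| |].
- intros H%clear_sound; change (X (vtx a)).
  replace (vtx a) with (combination 1 0 0 a a a) by (unfold combination; ring).
  apply H; lra.
- intros [H1 H2]%andb_prop; split; auto.
Qed.

Lemma push_nonempty st v : push st v <> [].
Proof.
induction st as [|b [|a st] IH]; try easy.
cbn [push]; destruct (clear a b v); easy.
Qed.

Lemma push_sound st v l :
  edges_in X (rev st ++ v :: l) ->
  edges_in X (rev (push st v) ++ l) /\
  poly_hom (rev st ++ v :: l) (rev (push st v) ++ l).
Proof.
assert (R : forall st, edges_in X (rev st ++ v :: l) ->
  edges_in X (rev (v :: st) ++ l) /\
  poly_hom (rev st ++ v :: l) (rev (v :: st) ++ l)).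
{ intros st0 H; simpl rev; rewrite <- app_assoc; split; [exact H|].
  apply poly_hom_refl; [now destruct (rev st0)|exact H]. }
induction st as [|b [|a st] IH]; intros H; [now apply R|now apply R|].
cbn [push]; destruct (clear a b v) eqn:E; [|now apply R].
apply clear_sound in E.
assert (E1 : rev (b :: a :: st) ++ v :: l = rev st ++ a :: b :: v :: l)
  by (simpl; now rewrite <- !app_assoc).
assert (E2 : rev (a :: st) ++ v :: l = rev st ++ a :: v :: l)
  by (simpl; now rewrite <- !app_assoc).
rewrite E1 in H |- *; rewrite E2 in IH.
destruct (IH (edges_in_delete _ _ _ _ _ H E)) as [IH1 IH2]; split; [exact IH1|].
exact (poly_hom_trans _ _ _ (polygon_delete _ _ _ _ _ H E) IH2).
Qed.

Lemma contract_sound l :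
  l <> [] -> edges_in X l -> poly_hom l (contract l).
Proof.
assert (G : forall l st, edges_in X (rev st ++ l) -> rev st ++ l <> [] ->
  poly_hom (rev st ++ l) (rev (fold_left push l st))).
{ clear l; intros l; induction l as [|v l IH]; intros st H N.
  - rewrite app_nil_r in *; now apply poly_hom_refl.
  - destruct (push_sound st v l H) as [H1 H2].
    simpl fold_left; eapply poly_hom_trans; [exact H2|].
    apply IH; [exact H1|].
    intros N'; apply app_eq_nil in N'; destruct N' as [N' _].
    apply (push_nonempty st v); rewrite <- (rev_involutive (push st v)), N'; reflexivity. }
intros N H; apply (G l []); assumption.
Qed.

(** The junction appears as a factor of its own: it is a genuine edge when a polygon is reversed,
    and a constant path when two loops meet at the base point. *)
Lemma polygon_app a l b l' :
  edges_in X (a :: l ++ b :: l') ->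
  hom X (vtx a) (vtx (final (b :: l'))) (polygon (a :: l ++ b :: l'))
    (path_mul (polygon (a :: l))
      (path_mul (segment (vtx (final (a :: l))) (vtx b)) (polygon (b :: l')))).
Proof.
revert a; induction l as [|c l IH]; intros a H.
- cbn [app final last].
  apply hom_sym, hom_1l.
  now apply (polygon_path_in a (b :: l')) in H.
- cbn [app] in H |- *; destruct H as [H1 H2].
  assert (L := hom_path_r _ _ _ _ _ (IH c H2)).
  rewrite final_cons.
  eapply hom_trans.
  + eapply hom_mul; [apply hom_refl, segment_path_in, H1|apply IH, H2].
  + assert (E : edges_in X (c :: l)).
    { clear - H2; revert c H2; induction l as [|d l IH]; intros c H.
      - destruct H as [H _]; change (X (vtx c)).
        replace (vtx c) with (combination 1 0 0 c b b) by (unfold combination; ring).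
        apply H; lra.
      - destruct H as [H1 H2]; split; auto. }
    assert (E' : edges_in X (final (c :: l) :: b :: l')).
    { clear - H2; revert c H2; induction l as [|d l IH]; intros c H; [exact H|].
      rewrite final_cons; apply IH, H. }
    apply hom_sym; eapply hom_assoc.
    * apply segment_path_in, H1.
    * apply polygon_path_in, E.
    * eapply path_in_mul; [apply segment_path_in, E'|apply polygon_path_in, E'].
Qed.

Lemma edges_in_rev l : edges_in X l -> edges_in X (rev l).
Proof.
assert (S : forall l a b, edges_in X (l ++ [a]) -> triangle_in X a b b ->
  edges_in X (l ++ [a; b])).
{ clear l; intros l a b; induction l as [|c l IH]; intros H HT.
  - split; [exact HT|]; change (X (vtx b)).
    replace (vtx b) with (combination 0 1 0 a b b) by (unfold combination; ring).
    apply HT; lra.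
  - cbn [app] in *; destruct l as [|d l]; cbn [app] in *; split.
    + apply H.
    + apply IH; [apply H|exact HT].
    + apply H.
    + apply IH; [apply H|exact HT]. }
induction l as [|a [|b l] IH]; intros H; [exact H|exact H|].
destruct H as [H1 H2]; specialize (IH H2); simpl in *.
rewrite <- app_assoc; apply S; [exact IH|].
intros x y z Hx Hy Hz E.
replace (combination x y z b a a) with (combination (y + z) x 0 a b b)
  by (unfold combination; rewrite RtoC_plus; ring).
apply H1; lra.
Qed.

Lemma path_inv_mul a b (s : R) :
  a 1 = b 0 -> path_inv (path_mul a b) s = path_mul (path_inv b) (path_inv a) s.
Proof.
intros E; unfold path_inv, path_mul.
destruct (Rle_dec (1 - s) (1 / 2)), (Rle_dec s (1 / 2)).
- replace (2 * (1 - s)) with 1 by lra; replace (1 - 2 * s) with 0 by lra; exact E.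
- f_equal; ring.
- f_equal; ring.
- lra.
Qed.

(** Products of segments are nested to the right and end with a constant path, so reversing the list
    gives the inverse only up to reassociation and removal of constants. *)
Lemma polygon_rev a l :
  edges_in X (a :: l) ->
  hom X (vtx (final (a :: l))) (vtx a) (polygon (rev (a :: l)))
    (path_inv (polygon (a :: l))).
Proof.
revert a; induction l as [|b l IH]; intros a H.
- apply (hom_refl X _ _ (fun _ => vtx a)), path_in_const, H.
- assert (HR := edges_in_rev _ H).
  destruct H as [H1 H2]; specialize (IH b H2).
  rewrite final_cons.
  assert (E : exists c q, rev (b :: l) = c :: q /\ c = final (b :: l) /\
    final (c :: q) = b).
  { destruct (rev (b :: l)) as [|c q] eqn:E.
    - apply (f_equal (@length _)) in E; rewrite length_rev in E; discriminate.
    - exists c, q; repeat split.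
      + rewrite <- (rev_involutive (b :: l)), E; simpl.
        now rewrite final_app.
      + rewrite <- E; simpl; now rewrite final_app. }
  destruct E as (c & q & E & E1 & E2).
  change (rev (a :: b :: l)) with (rev (b :: l) ++ [a]) in *.
  rewrite E in *; cbn [app] in HR |- *.
  apply hom_trans with (path_mul (path_inv (polygon (b :: l))) (segment (vtx b) (vtx a))).
  + rewrite <- E1 in IH |- *.
    eapply hom_trans; [apply (polygon_app c q a []), HR|].
    rewrite E2.
    assert (HS : path_in X (vtx b) (vtx a) (segment (vtx b) (vtx a))).
    { rewrite <- segment_inv; apply path_in_inv, segment_path_in, H1. }
    eapply hom_mul; [exact IH|exact (hom_1r _ _ _ _ HS)].
  + eapply hom_ext; [eapply hom_refl, path_in_mul|reflexivity|].
    * apply path_in_inv, polygon_path_in, H2.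
    * rewrite <- segment_inv; apply path_in_inv, segment_path_in, H1.
    * intros s _; rewrite <- segment_inv, <- path_inv_mul; [reflexivity|].
      rewrite segment_1; symmetry; apply (polygon_path_in _ _ H2).
Qed.

Definition loop_at (u : vertex) (q : list vertex) : list vertex := u :: q ++ [u].

(** One loop followed by the reverse of the other is contracted. Deletions never remove the two ends
    of the list, so success reads [[u; u]], whose polygon is constant. *)
Lemma loop_at_hom u q q' :
  edges_clear (loop_at u q ++ rev (loop_at u q')) = true ->
  contract (loop_at u q ++ rev (loop_at u q')) = [u; u] ->
  hom X (vtx u) (vtx u) (polygon (loop_at u q)) (polygon (loop_at u q')).
Proof.
unfold loop_at; intros HC%edges_clear_sound HE.
assert (HC1 : edges_in X (u :: q ++ [u])).
{ clear - HC; revert u HC.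
  assert (G : forall p r, edges_in X (p ++ r) -> edges_in X p).
  { induction p as [|a [|b p] IH]; intros r H; [exact I| |].
    - destruct r as [|b r]; [exact H|]; destruct H as [H _]; change (X (vtx a)).
      replace (vtx a) with (combination 1 0 0 a b b) by (unfold combination; ring).
      apply H; lra.
    - destruct H as [H1 H2]; split; [exact H1|apply (IH r), H2]. }
  intros u; apply G. }
assert (HC2 : edges_in X (u :: q' ++ [u])).
{ clear - HC.
  assert (G : forall p r, edges_in X (p ++ r) -> edges_in X r).
  { induction p as [|a p IH]; intros r H; [exact H|].
    apply IH; eapply edges_in_tl, H. }
  rewrite <- (rev_involutive (u :: q' ++ [u])); apply edges_in_rev, (G _ _ HC). }
assert (HR := polygon_rev u (q' ++ [u]) HC2).
assert (ER : rev (u :: q' ++ [u]) = u :: (rev q' ++ [u])).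
{ simpl; now rewrite rev_app_distr. }
rewrite ER in *.
assert (EF : forall q, final (u :: q ++ [u]) = u).
{ intros p; exact (final_app (u :: p) u []). }
rewrite EF in HR.
destruct (contract_sound ((u :: q ++ [u]) ++ u :: rev q' ++ [u]))
  as (_ & _ & K); [discriminate|exact HC|].
cbn [first hd app] in K.
assert (HA := polygon_app u (q ++ [u]) u (rev q' ++ [u]) HC).
rewrite !EF in HA.
assert (EF' : final (u :: (q ++ [u]) ++ u :: rev q' ++ [u]) = u).
{ exact (eq_trans (final_app (u :: q ++ [u]) u _) (EF _)). }
rewrite EF' in K.
cbn [app] in HE; rewrite HE in K.
assert (P1 := polygon_path_in _ _ HC1); assert (P2 := polygon_path_in _ _ HC2).
rewrite EF in P1, P2.
assert (Xu : X (vtx u)).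
{ destruct P1 as (_ & Q & <- & _); apply Q, I01_0. }
assert (M : hom X (vtx u) (vtx u) (fun _ => vtx u)
  (path_mul (polygon (u :: q ++ [u])) (path_inv (polygon (u :: q' ++ [u]))))).
{ apply hom_trans with (polygon [u; u]).
  - cbn [polygon]; rewrite segment_const.
    now apply hom_sym, hom_1l, path_in_const.
  - eapply hom_trans; [exact (hom_sym _ _ _ _ _ K)|].
    eapply hom_trans; [exact HA|].
    apply hom_mul with (vtx u); [exact (hom_refl _ _ _ _ P1)|].
    rewrite segment_const.
    eapply hom_trans; [|exact HR].
    apply hom_1l; eapply hom_path_l, HR. }
apply hom_sym.
eapply hom_trans; [apply hom_sym, hom_1l, P2|].
eapply hom_trans; [eapply hom_mul; [exact M|apply hom_refl, P2]|].
eapply hom_trans; [eapply hom_assoc; [exact P1|apply path_in_inv, P2|exact P2]|].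
eapply hom_trans; [eapply hom_mul; [apply hom_refl, P1|eapply hom_inv_l, P2]|].
now apply hom_1r.
Qed.

End Polygons.

(** * Words in loops *)

(* The letter [k > 0] stands for the [k]-th generator, [- k] for its inverse. *)
Definition word : Type := list Z.

Definition letter (u : C) (x : nat -> path) (k : Z) : path :=
  match k with
  | Z0 => fun _ => u
  | Zpos p => x (Pos.to_nat p)
  | Zneg p => path_inv (x (Pos.to_nat p))
  end.

Fixpoint eval (u : C) (x : nat -> path) (w : word) : path :=
  match w with
  | [] => fun _ => u
  | k :: w => path_mul (letter u x k) (eval u x w)
  end.

Definition word_inv (w : word) : word := rev (map Z.opp w).

Definition reduce (w : word) : word :=
  fold_right (fun k w => match w with
    | [] => [k]
    | k' :: w' => if (k' =? - k)%Z then w' else k :: w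
    end) [] w.

Definition subst (T : nat -> word) (w : word) : word :=
  flat_map (fun k => match k with
    | Z0 => []
    | Zpos p => T (Pos.to_nat p)
    | Zneg p => word_inv (T (Pos.to_nat p))
    end) w.

Lemma image_eval f u x w :
  image f (eval u x w) = eval (f u) (fun j => image f (x j)) w.
Proof.
induction w as [|k w IH]; [reflexivity|].
cbn [eval]; rewrite image_mul, IH; destruct k; reflexivity.
Qed.

Section Words.

Variables (X : C -> Prop) (u : C).
Hypothesis Xu : X u.

(** All natural indices are included; the families of loops used later repeat the sixth loop at 0
    and beyond 6. *)
Definition loops (x : nat -> path) : Prop := forall j, path_in X u u (x j).

Local Notation "a =~ b" := (hom X u u a b) (at level 70).

Lemma hom_const : (fun _ => u) =~ (fun _ => u).
Proof. now apply (hom_refl X u u (fun _ => u)), path_in_const. Qed.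

Section Eval.

Variable x : nat -> path.
Hypothesis Hx : loops x.

Lemma letter_path_in k : path_in X u u (letter u x k).
Proof.
destruct k; [now apply path_in_const|apply Hx|apply path_in_inv, Hx].
Qed.

Lemma eval_path_in w : path_in X u u (eval u x w).
Proof.
induction w as [|k w IH]; [now apply path_in_const|].
eapply path_in_mul; [apply letter_path_in|exact IH].
Qed.

Lemma eval_app w w' : eval u x (w ++ w') =~ path_mul (eval u x w) (eval u x w').
Proof.
induction w as [|k w IH].
- apply hom_sym, hom_1l, eval_path_in.
- cbn [app eval].
  eapply hom_trans; [eapply hom_mul; [apply hom_refl, letter_path_in|exact IH]|].
  eapply hom_sym, hom_assoc; [apply letter_path_in|apply eval_path_in|apply eval_path_in].
Qed.

Lemma letter_opp k : letter u x (- k) = path_inv (letter u x k).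
Proof. destruct k; try reflexivity; simpl; now rewrite path_inv_inv. Qed.

Lemma eval_cancel k w : eval u x (k :: (- k)%Z :: w) =~ eval u x w.
Proof.
cbn [eval]; rewrite letter_opp.
assert (Hk := letter_path_in k); assert (Hw := eval_path_in w).
eapply hom_trans; [eapply hom_sym, hom_assoc; [exact Hk|apply path_in_inv, Hk|exact Hw]|].
eapply hom_trans; [eapply hom_mul; [eapply hom_inv_r, Hk|apply hom_refl, Hw]|].
now apply hom_1l.
Qed.

Lemma eval_reduce w : eval u x (reduce w) =~ eval u x w.
Proof.
induction w as [|k w IH]; [exact hom_const|].
assert (Hk := hom_refl _ _ _ _ (letter_path_in k)).
assert (H : eval u x (k :: reduce w) =~ eval u x (k :: w))
  by (eapply hom_mul; [exact Hk|exact IH]).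
simpl reduce; fold (reduce w).
destruct (reduce w) as [|k' w'] eqn:E; [exact H|].
destruct (Z.eqb_spec k' (- k)) as [->|_]; [|exact H].
eapply hom_trans; [apply hom_sym, (eval_cancel k)|exact H].
Qed.

Lemma eval_inv w : eval u x (word_inv w) =~ path_inv (eval u x w).
Proof.
unfold word_inv; induction w as [|k w IH].
- exact hom_const.
- assert (Hk := letter_path_in k); assert (Hw := eval_path_in w).
  simpl; eapply hom_trans; [apply eval_app|].
  eapply hom_trans.
  { eapply hom_mul; [exact IH|].
    cbn [eval]; rewrite letter_opp; apply hom_1r, path_in_inv, Hk. }
  eapply hom_ext; [eapply hom_refl, path_in_mul; apply path_in_inv|reflexivity|].
  + exact Hw.
  + exact Hk.
  + intros s _; rewrite <- path_inv_mul; [reflexivity|].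
    destruct Hk as (_ & _ & _ & ->), Hw as (_ & _ & -> & _); reflexivity.
Qed.

Lemma eval_mul_inv w w' :
  eval u x (w ++ word_inv w') =~ path_mul (eval u x w) (path_inv (eval u x w')).
Proof.
eapply hom_trans; [apply eval_app|].
eapply hom_mul; [apply hom_refl, eval_path_in|apply eval_inv].
Qed.

End Eval.

Lemma eval_subst x y T w :
  loops y -> (forall j, x j =~ eval u y (T j)) ->
  eval u x w =~ eval u y (subst T w).
Proof.
intros Hy H; induction w as [|k w IH]; [exact hom_const|].
cbn [eval subst flat_map].
eapply hom_trans; [|apply hom_sym, (eval_app y Hy)].
eapply hom_mul; [|exact IH].
destruct k; cbn [letter].
- exact hom_const.
- apply H.
- eapply hom_trans; [eapply hom_inv, H|].
  apply hom_sym, eval_inv, Hy.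
Qed.

Lemma eval_congr x y w :
  (forall j, x j =~ y j) -> eval u x w =~ eval u y w.
Proof.
intros H; induction w as [|k w IH]; [exact hom_const|].
eapply hom_mul; [|exact IH].
destruct k; cbn [letter]; [exact hom_const|apply H|].
eapply hom_inv, H.
Qed.

End Words.

(** * Certified polygonal homotopies *)

(** The doubled [u] closes one based loop and opens the next, so the list is literally an append of
    loops; the degenerate edge in between is a constant path. The empty list at the end matches the
    final constant factor of [eval]. *)
Fixpoint concat_loops (u : vertex) (L : nat -> list vertex) (w : word)
  : list vertex :=
  match w with
  | [] => []
  | k :: w =>
      match k with
      | Z0 => []
      | Zpos p => L (Pos.to_nat p)
      | Zneg p => rev (L (Pos.to_nat p))
      end ++ u :: u :: concat_loops u L w
  end.

Section ConcatLoops.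

Variables (X : C -> Prop) (u : vertex) (L : nat -> list vertex).
Hypothesis HL : forall j, edges_in X (loop_at u (L j)).

Lemma final_loop_at q : final (loop_at u q) = u.
Proof. exact (final_app (u :: q) u []). Qed.

Lemma loop_at_path_in q :
  edges_in X (loop_at u q) -> path_in X (vtx u) (vtx u) (polygon (loop_at u q)).
Proof.
intros H; rewrite <- (final_loop_at q) at 2; now apply polygon_path_in.
Qed.

Lemma loop_at_app q q' :
  loop_at u (q ++ u :: u :: q') = loop_at u q ++ loop_at u q'.
Proof. unfold loop_at; cbn [app]; now rewrite <- !app_assoc. Qed.

Lemma rev_loop_at q : rev (loop_at u q) = loop_at u (rev q).
Proof. unfold loop_at; simpl; now rewrite rev_app_distr. Qed.

Lemma vtx_in : X (vtx u).
Proof.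
destruct (loop_at_path_in _ (HL 0)) as (_ & H & <- & _); apply H, I01_0.
Qed.

Lemma edges_in_loops q q' :
  edges_in X (loop_at u q) -> edges_in X (loop_at u q') ->
  edges_in X (loop_at u (q ++ u :: u :: q')).
Proof.
rewrite loop_at_app; intros H H'.
assert (G : forall l, edges_in X (l ++ [u]) ->
  edges_in X ((l ++ [u]) ++ loop_at u q')).
{ induction l as [|a l IH]; intros Hl.
  - split; [|exact H'].
    intros x y z Hx Hy Hz E.
    replace (combination x y z u u u) with (vtx u); [apply vtx_in|].
    unfold combination; rewrite <- !Cmult_plus_distr_r, <- !RtoC_plus, E; ring.
  - cbn [app] in *; destruct l as [|b l]; cbn [app] in *; split;
    [apply Hl|apply IH, Hl|apply Hl|apply IH, Hl]. }
apply (G (u :: q)), H.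
Qed.

Lemma polygon_concat q q' :
  edges_in X (loop_at u q) -> edges_in X (loop_at u q') ->
  hom X (vtx u) (vtx u) (polygon (loop_at u (q ++ u :: u :: q')))
    (path_mul (polygon (loop_at u q)) (polygon (loop_at u q'))).
Proof.
intros H H'.
assert (HE := edges_in_loops q q' H H'); rewrite loop_at_app in *.
assert (HA := polygon_app X u (q ++ [u]) u (q' ++ [u]) HE).
fold (loop_at u q) in HA; fold (loop_at u q') in HA; rewrite !final_loop_at in HA.
eapply hom_trans; [exact HA|].
eapply hom_mul; [apply hom_refl, loop_at_path_in, H|].
rewrite segment_const; apply hom_1l, loop_at_path_in, H'.
Qed.

Lemma concat_loops_hom w :
  edges_in X (loop_at u (concat_loops u L w)) /\
  hom X (vtx u) (vtx u) (polygon (loop_at u (concat_loops u L w)))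
    (eval (vtx u) (fun j => polygon (loop_at u (L j))) w).
Proof.
assert (E0 : edges_in X (loop_at u [])).
{ split; [|exact vtx_in].
  intros x y z Hx Hy Hz E.
  replace (combination x y z u u u) with (vtx u); [exact vtx_in|].
  unfold combination; rewrite <- !Cmult_plus_distr_r, <- !RtoC_plus, E; ring. }
assert (H0 : hom X (vtx u) (vtx u) (polygon (loop_at u [])) (fun _ => vtx u)).
{ cbn [loop_at app polygon]; rewrite segment_const; apply hom_1l, path_in_const, vtx_in. }
induction w as [|k w [IH1 IH2]]; [now split|].
cbn [concat_loops eval].
match goal with |- context [?q ++ u :: u :: _] => set (q0 := q) end.
assert (K : edges_in X (loop_at u q0) /\ hom X (vtx u) (vtx u)
  (polygon (loop_at u q0)) (letter (vtx u) (fun j => polygon (loop_at u (L j))) k)).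
{ unfold q0; destruct k as [|p|p]; cbn [letter].
  - now split.
  - split; [apply HL|]; apply hom_refl, loop_at_path_in, HL.
  - rewrite <- rev_loop_at; split; [apply edges_in_rev, HL|].
    assert (R := polygon_rev X u (L (Pos.to_nat p) ++ [u]) (HL _)).
    fold (loop_at u (L (Pos.to_nat p))) in R; now rewrite final_loop_at in R. }
destruct K as [K1 K2]; split; [now apply edges_in_loops|].
eapply hom_trans; [now apply polygon_concat|].
eapply hom_mul; eassumption.
Qed.

End ConcatLoops.

(* The triangle with the given corners, possibly degenerate. *)
Definition region : Type := (vertex * vertex * vertex)%type.

Definition in_region (p : C) (r : region) : Prop :=
  let '(a, b, c) := r in
  exists y z, 0 <= y /\ 0 <= z /\ y + z <= 1 /\ p = combination (1 - y - z) y z a b c.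

Definition covers (regs : list region) (P : C -> Prop) : Prop :=
  forall p, P p -> exists r, In r regs /\ in_region p r.

Definition dot (d v : vertex) : Z := (fst d * fst v + snd d * snd v)%Z.

(* A line separating two triangles is only looked for among these normals. *)
Definition directions : list vertex :=
  let l := [0; 1; -1; 2; -2; 3; -3; 4; -4]%Z in
  filter (fun d => Z.gcd (fst d) (snd d) =? 1)%Z (list_prod l l).

(** 160000 is the square of the radius 4, in hundredths. *)
Definition in_disk (v : vertex) : bool :=
  (fst v * fst v + snd v * snd v <=? 160000)%Z.

(** One side of the line is enough, as [directions] is closed under negation. *)
Definition below (d : vertex) (r : region) (v : vertex) : bool :=
  let '(a, b, c) := r in
  let n := dot d v in (n <? dot d a)%Z &&& (n <? dot d b)%Z &&& (n <? dot d c)%Z.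

(* With the strict connectives [vm_compute] would try every direction. *)
Fixpoint separated (ds : list vertex) (r : region) (a b c : vertex) : bool :=
  match ds with
  | [] => false
  | d :: ds => (below d r a &&& below d r b &&& below d r c) ||| separated ds r a b c
  end.

Fixpoint all_separated (regs : list region) (a b c : vertex) : bool :=
  match regs with
  | [] => true
  | r :: regs => separated directions r a b c &&& all_separated regs a b c
  end.

Definition clear (regs : list region) (a b c : vertex) : bool :=
  in_disk a &&& in_disk b &&& in_disk c &&& all_separated regs a b c.

Lemma lazy_andb_prop (a b : bool) : (a &&& b) = true -> a = true /\ b = true.
Proof. now destruct a. Qed.

Lemma separated_direction ds r a b c : separated ds r a b c = true ->
  exists d, below d r a = true /\ below d r b = true /\ below d r c = true.
Proof.
induction ds as [|d ds IH]; [easy|]; cbn [separated].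
destruct (below d r a) eqn:Ea, (below d r b) eqn:Eb, (below d r c) eqn:Ec;
try exact IH; now exists d.
Qed.

Lemma all_separated_in regs a b c r :
  all_separated regs a b c = true -> In r regs -> separated directions r a b c = true.
Proof.
induction regs as [|r' regs IH]; [easy|].
intros [H1 H2]%lazy_andb_prop [->|Hin]; auto.
Qed.

Lemma disk_vtx v : in_disk v = true -> disk (vtx v).
Proof.
intros H%Z.leb_le%IZR_le; rewrite plus_IZR, !mult_IZR in H.
unfold disk, Cmod, vtx; cbn [fst snd].
rewrite <- (sqrt_square 4) by lra; apply sqrt_le_1_alt; lra.
Qed.

Lemma disk_combination x y z a b c :
  0 <= x -> 0 <= y -> 0 <= z -> x + y + z = 1 ->
  disk (vtx a) -> disk (vtx b) -> disk (vtx c) -> disk (combination x y z a b c).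
Proof.
unfold disk, combination; intros Hx Hy Hz E Ha Hb Hc.
eapply Rle_trans; [apply Cmod_triangle|].
eapply Rle_trans; [apply Rplus_le_compat_r, Cmod_triangle|].
rewrite !Cmod_mult, !Cmod_R, !Rabs_pos_eq by assumption.
assert (x * Cmod (vtx a) <= x * 4) by (now apply Rmult_le_compat_l).
assert (y * Cmod (vtx b) <= y * 4) by (now apply Rmult_le_compat_l).
assert (z * Cmod (vtx c) <= z * 4) by (now apply Rmult_le_compat_l).
lra.
Qed.

Lemma separation x y z y' z' va vb vc a b c m :
  0 <= x -> 0 <= y -> 0 <= z -> x + y + z = 1 ->
  0 <= y' -> 0 <= z' -> y' + z' <= 1 ->
  va < m -> vb < m -> vc < m -> m <= a -> m <= b -> m <= c ->
  x * va + y * vb + z * vc < (1 - y' - z') * a + y' * b + z' * c.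
Proof.
intros Hx Hy Hz E Hy' Hz' E' Hva Hvb Hvc Ha Hb Hc.
(* Some weights may vanish, so strictness cannot be read off term by term; it is carried by the gap
   between the largest of the [v] values and [m]. *)
set (M := Rmax va (Rmax vb vc)).
assert (M < m) by (unfold M; repeat apply Rmax_lub_lt; assumption).
assert (va <= M) by apply Rmax_l.
assert (vb <= M) by (eapply Rle_trans; [apply Rmax_l|apply Rmax_r]).
assert (vc <= M) by (eapply Rle_trans; [apply Rmax_r|apply Rmax_r]).
apply Rle_lt_trans with M; [|apply Rlt_le_trans with m; [assumption|]].
- replace M with (x * M + y * M + z * M) by (rewrite <- !Rmult_plus_distr_r, E; ring).
  repeat apply Rplus_le_compat; apply Rmult_le_compat_l; assumption.
- replace m with ((1 - y' - z') * m + y' * m + z' * m) at 1 by ring.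
  repeat apply Rplus_le_compat; apply Rmult_le_compat_l; lra.
Qed.

Definition rdot (d : vertex) (z : C) : R := IZR (fst d) * fst z + IZR (snd d) * snd z.

Lemma rdot_vtx d v : rdot d (vtx v) = IZR (dot d v) / 100.
Proof. unfold rdot, vtx, dot; simpl; rewrite plus_IZR, !mult_IZR; field. Qed.

Lemma rdot_combination d x y z a b c :
  rdot d (combination x y z a b c) =
  x * rdot d (vtx a) + y * rdot d (vtx b) + z * rdot d (vtx c).
Proof. unfold rdot, combination; simpl; ring. Qed.

(** By convexity the linear form [rdot d] is strictly smaller on the triangle than on the region, so
    they have no common point; the disk, being convex, contains the triangle as soon as it contains
    the corners. *)
Lemma clear_sound regs P : covers regs P ->
  forall a b c, clear regs a b c = true -> triangle_in (avoid P) a b c.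
Proof.
intros HP a b c H x y z Hx Hy Hz E.
apply lazy_andb_prop in H; destruct H as [H HR].
apply lazy_andb_prop in H; destruct H as [H Hc].
apply lazy_andb_prop in H; destruct H as [Ha Hb].
split; [apply disk_combination; auto using disk_vtx|].
intros Hp; destruct (HP _ Hp) as ([[ra rb] rc] & Hin & y' & z' & Hy' & Hz' & E' & EQ).
apply (all_separated_in _ _ _ _ _ HR), separated_direction in Hin.
destruct Hin as (d & Da & Db & Dc).
apply (f_equal (rdot d)) in EQ; rewrite !rdot_combination in EQ.
revert EQ; apply Rlt_not_eq.
unfold below in Da, Db, Dc; cbv zeta in Da, Db, Dc.
repeat match goal with
| H : (_ &&& _) = true |- _ => apply lazy_andb_prop in H; destruct H
| H : (_ <? _)%Z = true |- _ => apply Z.ltb_lt, IZR_lt in H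
end.
rewrite !rdot_vtx.
apply separation with
  (m := Rmin (IZR (dot d ra)) (Rmin (IZR (dot d rb)) (IZR (dot d rc))) / 100); auto;
unfold Rmin; repeat destruct (Rle_dec _ _); lra.
Qed.

Fixpoint vertices_eqb (l l' : list vertex) : bool :=
  match l, l' with
  | [], [] => true
  | a :: l, b :: l' => ((fst a =? fst b) && (snd a =? snd b))%Z && vertices_eqb l l'
  | _, _ => false
  end.

Lemma vertices_eqb_eq l l' : vertices_eqb l l' = true -> l = l'.
Proof.
revert l'; induction l as [|[a1 a2] l IH]; destruct l' as [|[b1 b2] l']; try easy.
simpl; intros H; apply andb_prop in H; destruct H as [H H'].
apply andb_prop in H; destruct H as [H1%Z.eqb_eq H2%Z.eqb_eq].
now rewrite H1, H2, (IH l' H').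
Qed.

Definition loop_clear (regs : list region) (u : vertex) (q : list vertex) : bool :=
  edges_clear (clear regs) (loop_at u q).

Definition homotopic_check (regs : list region) (u : vertex) (q q' : list vertex)
  : bool :=
  let l := loop_at u q ++ rev (loop_at u q') in
  edges_clear (clear regs) l && vertices_eqb (contract (clear regs) l) [u; u].

Section Check.

Variables (regs : list region) (P : C -> Prop) (u : vertex).
Hypothesis HP : covers regs P.

Lemma loop_clear_edges q :
  loop_clear regs u q = true -> edges_in (avoid P) (loop_at u q).
Proof. apply edges_clear_sound; now apply clear_sound. Qed.

Lemma loop_clear_path_in q :
  loop_clear regs u q = true ->
  path_in (avoid P) (vtx u) (vtx u) (polygon (loop_at u q)).
Proof. intros H; now apply loop_at_path_in, loop_clear_edges. Qed.

Lemma homotopic_check_sound q q' :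
  homotopic_check regs u q q' = true ->
  hom (avoid P) (vtx u) (vtx u) (polygon (loop_at u q)) (polygon (loop_at u q')).
Proof.
intros H; apply andb_prop in H; destruct H as [H1 H2%vertices_eqb_eq].
apply (loop_at_hom _ (clear regs)); auto; now apply clear_sound.
Qed.

Lemma word_check_sound q (L : nat -> list vertex) (w : word) :
  (forall j, loop_clear regs u (L j) = true) ->
  homotopic_check regs u q (concat_loops u L w) = true ->
  hom (avoid P) (vtx u) (vtx u) (polygon (loop_at u q))
    (eval (vtx u) (fun j => polygon (loop_at u (L j))) w).
Proof.
intros HL H.
eapply hom_trans; [now apply homotopic_check_sound, H|].
apply concat_loops_hom; intros j; now apply loop_clear_edges.
Qed.

End Check.

(** * Normal closures *)

Fixpoint word_eqb (w w' : word) : bool :=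
  match w, w' with
  | [], [] => true
  | k :: w, k' :: w' => (k =? k')%Z && word_eqb w w'
  | _, _ => false
  end.

Lemma word_eqb_eq w w' : word_eqb w w' = true -> w = w'.
Proof.
revert w'; induction w as [|k w IH]; destruct w' as [|k' w']; try easy.
simpl; intros H; apply andb_prop in H; destruct H as [->%Z.eqb_eq H].
now rewrite (IH w' H).
Qed.

(* [(c, k, b)] stands for the conjugate by [c] of the [k]-th relator if [b],
   of its inverse otherwise. *)
Definition certificate : Type := list (word * nat * bool).

Definition expand (rs : list word) (cert : certificate) : word :=
  flat_map (fun '(c, k, b) =>
    let r := nth k rs [] in
    c ++ (if b : bool then r else word_inv r) ++ word_inv c) cert.

Definition derives (rs : list word) (r : word) (cert : certificate) : bool :=
  word_eqb (reduce r) (reduce (expand rs cert)).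

Section NormalClosure.

Variables (X : C -> Prop) (u : C) (x : nat -> path).
Hypotheses (Xu : X u) (Hx : loops X u x).

Definition represents (ab : path * path) (r : word) : Prop :=
  hom X u u (path_mul (fst ab) (path_inv (snd ab))) (eval u x r).

Section Relators.

Variables (rels : list (path * path)) (rs : list word).
Hypotheses (loop_rels : forall a b, In (a, b) rels -> is_loop X u a /\ is_loop X u b)
  (Hrels : Forall2 represents rels rs).

Lemma relator_in_closure r : In r rs -> normal_closure X u rels (eval u x r).
Proof.
intros Hr.
assert (H : exists ab, In ab rels /\ represents ab r).
{ clear loop_rels; induction Hrels as [|ab r' l l' H0 H IH]; [easy|].
  destruct Hr as [->|Hr].
  - exists ab; split; [now left|exact H0].
  - destruct (IH H Hr) as (ab' & H1 & H2); exists ab'; split; [now right|exact H2]. }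
destruct H as ([a b] & Hin & Hab); destruct (loop_rels a b Hin).
apply nc_homotopic with (path_mul a (path_inv b)); [now apply nc_rel|exact Hab].
Qed.

Lemma expand_in_closure cert : normal_closure X u rels (eval u x (expand rs cert)).
Proof.
induction cert as [|[[c k] b] cert IH]; [exact (nc_one X u _ Xu)|].
cbn [expand flat_map]; fold (expand rs cert).
set (r := nth k rs []).
assert (Hr : normal_closure X u rels (eval u x r)).
(* An index out of range selects the empty word, which lies in every normal closure. *)
{ destruct (nth_in_or_default k rs []) as [H|H]; [now apply relator_in_closure|].
  unfold r; rewrite H; exact (nc_one X u _ Xu). }
assert (Hr' : normal_closure X u rels (eval u x (if b then r else word_inv r))).
{ destruct b; [exact Hr|].
  eapply nc_homotopic; [apply nc_inv, Hr|].
  now apply hom_sym, eval_inv. }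
eapply nc_homotopic.
- eapply nc_mul; [eapply nc_conj; [exact Hr'|apply (eval_path_in X u Xu x Hx c)]|exact IH].
- apply hom_sym; eapply hom_trans; [now apply eval_app|].
  eapply hom_mul; [|now apply hom_refl, eval_path_in].
  rewrite app_assoc.
  eapply hom_trans; [now apply eval_mul_inv|].
  eapply hom_mul; [now apply eval_app|].
  now apply hom_refl, path_in_inv, eval_path_in.
Qed.

Lemma derives_sound r cert :
  derives rs r cert = true -> normal_closure X u rels (eval u x r).
Proof.
intros H%word_eqb_eq.
eapply nc_homotopic; [apply (expand_in_closure cert)|].
eapply hom_trans; [apply hom_sym, (eval_reduce X u Xu x Hx)|].
rewrite <- H; now apply eval_reduce.
Qed.

End Relators.

Lemma normal_closure_incl rels rels' rs rs' certs :
  (forall a b, In (a, b) rels' -> is_loop X u a /\ is_loop X u b) ->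
  Forall2 represents rels rs -> Forall2 represents rels' rs' ->
  Forall2 (fun r cert => derives rs' r cert = true) rs certs ->
  forall a, normal_closure X u rels a -> normal_closure X u rels' a.
Proof.
intros HL HR HR' HD a H.
induction H.
- assert (E : exists r cert, represents (a, b) r /\ derives rs' r cert = true).
  { revert certs HD H; clear - HR.
    induction HR as [|ab r l l' H0 H IH]; intros certs HD Hin; [easy|].
    inversion_clear HD as [|? ? ? certs' D HD'].
    destruct Hin as [->|Hin]; [now exists r, y|exact (IH _ HD' Hin)]. }
  destruct E as (r & cert & Hr & Hd).
  eapply nc_homotopic; [eapply (derives_sound rels' rs'); eassumption|].
  now apply hom_sym.
- exact (nc_one X u _ Xu).
- now apply nc_mul.
- now apply nc_inv.
- now apply nc_conj.
- eapply nc_homotopic; eassumption.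
Qed.

Lemma represents_letter k :
  hom X u u (letter u x k) (eval u x [k]).
Proof. now apply hom_sym, hom_1r, letter_path_in. Qed.

Lemma represents_mul a b w w' :
  hom X u u a (eval u x w) -> hom X u u b (eval u x w') ->
  hom X u u (path_mul a b) (eval u x (w ++ w')).
Proof.
intros Ha Hb; eapply hom_trans; [eapply hom_mul; eassumption|].
now apply hom_sym, eval_app.
Qed.

Lemma represents_inv a w :
  hom X u u a (eval u x w) -> hom X u u (path_inv a) (eval u x (word_inv w)).
Proof.
intros Ha; eapply hom_trans; [eapply hom_inv; eassumption|].
now apply hom_sym, eval_inv.
Qed.

Lemma represents_relation a b w w' :
  hom X u u a (eval u x w) -> hom X u u b (eval u x w') ->
  represents (a, b) (w ++ word_inv w').
Proof. intros Ha Hb; apply represents_mul; [exact Ha|now apply represents_inv]. Qed.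

(** * Derivation of each set of relations from the other *)

Definition relation_words : list (word * word) :=
  [([5; 4; 3; 2], [2; 5; 4; 3]);
   ([2; 5; 4; 3], [3; 2; 5; 4]);
   ([4; 5; 4; 3; 2; 5], [5; 4; 3; 2; 5; 4]);
   ([1], [5; 4; -5]);
   ([5], [6])]%Z.

Definition monodromy_word (j : nat) : word :=
  match j with
  | 1%nat => [5; 4; -5]
  | 2%nat => [5; 4; 3; 2; -3; -4; -5]
  | 3%nat => [5; 4; 3; 2; 3; -2; -3; -4; -5]
  | 4%nat => [5; 4; 3; 2; 1; -2; -3; -4; -5]
  | 5%nat => [6]
  | _ => [6; 5; 4; 3; 2; 1; 5; -1; -2; -3; -4; -5; -6]
  end%Z.

Definition relator (ww : word * word) : word := fst ww ++ word_inv (snd ww).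

Definition relators : list word := map relator relation_words.

Definition monodromy_relators : list word :=
  map (fun j => relator (monodromy_word j, [Z.of_nat j])) (List.seq 1 6).

Lemma represents_words l ww :
  Forall2 (fun ab vw => hom X u u (fst ab) (eval u x (fst vw)) /\
    hom X u u (snd ab) (eval u x (snd vw))) l ww ->
  Forall2 represents l (map relator ww) /\
  forall a b, In (a, b) l -> is_loop X u a /\ is_loop X u b.
Proof.
induction 1 as [|[a b] [v w] l ww [H1 H2] _ [IH1 IH2]]; [now split|]; split.
- constructor; [now apply represents_relation|exact IH1].
- intros a' b' [[= <- <-]|Hin]; [|now apply IH2].
  split; eapply hom_path_l; eassumption.
Qed.

Lemma relations_represented :
  Forall2 (fun ab vw => hom X u u (fst ab) (eval u x (fst vw)) /\
    hom X u u (snd ab) (eval u x (snd vw))) (relations x) relation_words.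
Proof.
assert (L := represents_letter).
repeat constructor; cbn [fst snd];
repeat match goal with
| |- hom _ _ _ (path_mul _ _) (eval _ _ [?a; ?b; ?c; ?d; ?e; ?f]) =>
    apply (represents_mul _ _ [a; b; c; d; e] [f])
| |- hom _ _ _ (path_mul _ _) (eval _ _ [?a; ?b; ?c; ?d; ?e]) =>
    apply (represents_mul _ _ [a; b; c; d] [e])
| |- hom _ _ _ (path_mul _ _) (eval _ _ [?a; ?b; ?c; ?d]) =>
    apply (represents_mul _ _ [a; b; c] [d])
| |- hom _ _ _ (path_mul _ _) (eval _ _ [?a; ?b; ?c]) =>
    apply (represents_mul _ _ [a; b] [c])
| |- hom _ _ _ (path_mul _ _) (eval _ _ [?a; ?b]) =>
    apply (represents_mul _ _ [a] [b])
| |- hom _ _ _ _ (eval _ _ [?a]) => exact (L a)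
end.
Qed.

Lemma normal_closures_equal beta :
  (forall j, (1 <= j <= 6)%nat ->
     hom X u u (image beta (x j)) (eval u x (monodromy_word j))) ->
  same_normal_closure X u (relations x) (induced_relations beta x).
Proof.
intros Hb.
assert (HR := represents_words _ _ relations_represented).
assert (HI : Forall2 (fun ab vw => hom X u u (fst ab) (eval u x (fst vw)) /\
    hom X u u (snd ab) (eval u x (snd vw))) (induced_relations beta x)
    (map (fun j => (monodromy_word j, [Z.of_nat j])) (List.seq 1 6))).
{ repeat constructor; cbn [fst snd];
  first [ apply (represents_letter 1) | apply (represents_letter 2)
        | apply (represents_letter 3) | apply (represents_letter 4)
        | apply (represents_letter 5) | apply (represents_letter 6)
        | apply Hb; lia ]. }
apply represents_words in HI; rewrite map_map in HI.
fold monodromy_relators in HI; fold relators in HR.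
destruct HR as [HR LR], HI as [HI LI].
intros a; split.
(* The invariance of x1, x2 and x5 is relation (3), the first equality of (1) and relation (4), up
   to inversion. Given that first equality, the second one says that x3 commutes with x5 x4 x3 x2,
   which is the invariance of x3. Relation (2) is the invariance of x4 once x1 is eliminated by
   (3). *)
- apply (normal_closure_incl _ _ relators monodromy_relators [
    [([], 1%nat, true)];
    [([2; 5; 4; 3; -4; -5; -2], 1%nat, true);
     ([2; 5; 4; 3; 3; -2; -3; -4; -5; -3], 2%nat, true);
     ([], 1%nat, false)];
    [([4; 5; 4; 3; 2; 5; -4; -5], 0%nat, false); ([], 3%nat, false)];
    [([], 0%nat, false)];
    [([], 4%nat, false)]]%Z); auto.
  repeat constructor.
- apply (normal_closure_incl _ _ monodromy_relators relators [
    [([], 3%nat, false)];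
    [([], 0%nat, true)];
    [([5; 4; 3; 2; 3; -2; -3; -4; -5], 0%nat, false);
     ([], 0%nat, true); ([], 1%nat, true)];
    [([5; 4; 3; 2; 1; -2; -3; -4; -5; -4], 2%nat, false);
     ([5; 4; 3; 2], 3%nat, true)];
    [([], 4%nat, false)];
    (* Modulo (2) and (3) the product x5 x4 x3 x2 x1 equals x4 x5 x4 x3 x2, which commutes with x5
       by (2) and (1). The image of x6 thus reduces to x6 x5 x6^-1, which is x6 by (4). *)
    [([6; 5; 4; 3; 2; 1; 5; -1], 3%nat, false);
     ([6; 5; 4; 3; 2; 1; 5; 5; -4; -5; -2; -3; -4; -5], 2%nat, true);
     ([6; 5; 4; 3; 2; 1; 5; -2; -3; -4; -5], 0%nat, false);
     ([6; 5; 4; 3; 2; 1; 5; -3; -4; -5; -2], 1%nat, false);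
     ([6; 5; 4; 3; 2], 3%nat, true);
     ([6], 4%nat, true)]]%Z); auto.
  repeat constructor.
Qed.

End NormalClosure.

Definition base : vertex := (0, -400)%Z.

Lemma vtx_base : vtx base = u0.
Proof. apply injective_projections; simpl; field. Qed.

Lemma u0_boundary : Cmod u0 = 4.
Proof.
unfold u0; rewrite Cmod_opp, Cmod_mult, Cmod_R, Rabs_pos_eq by lra.
replace (Cmod Ci) with 1; [ring|].
unfold Cmod, Ci; simpl; replace (0 * (0 * 1) + 1 * (1 * 1)) with 1 by ring.
now rewrite sqrt_1.
Qed.

Lemma hom_mono (X Y : C -> Prop) u v a b :
  (forall z, X z -> Y z) -> hom X u v a b -> hom Y u v a b.
Proof. intros H (K & K1 & K2 & K3); exists K; auto. Qed.

Lemma path_in_mono (X Y : C -> Prop) u v a :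
  (forall z, X z -> Y z) -> path_in X u v a -> path_in Y u v a.
Proof. intros H (K1 & K2 & K3); split; [exact K1|]; split; auto. Qed.

(** * The loops of the standard g-base as polygons *)

(** The corners of the squares are [p + 2/25 * d * i^n] with [d = u0 - p]. The factor 2/25 makes
    them integral in hundredths for every model point, and their distance to [p], at most 2/5, is
    less than the least distance 1/2 between model points. *)
Definition lasso_loop (j : nat) : list vertex :=
  match j with
  | 1%nat => [(-92, -32); (-68, 8); (-108, 32); (-132, -8); (-92, -32)]
  | 2%nat => [(-46, -32); (-18, 4); (-54, 32); (-82, -4); (-46, -32)]
  | 3%nat => [(0, -32); (32, 0); (0, 32); (-32, 0); (0, -32)]
  | 4%nat => [(92, -32); (132, -8); (108, 32); (68, 8); (92, -32)]
  | 5%nat => [(184, -32); (232, -16); (216, 32); (168, 16); (184, -32)]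
  | _ => [(276, -32); (332, -24); (324, 32); (268, 24); (276, -32)]
  end%Z.

Definition model_set (y : C) : Prop :=
  exists i, (1 <= i <= 6)%nat /\ model_point i = y.

Definition quarter (z : C) : C := (Ci * z)%C.

(* Nested so that each side is traversed in a quarter of the unit interval, like
   the corresponding arc of the circle. *)
Definition unit_square : path :=
  path_mul (path_mul (segment (RtoC 1) Ci) (segment Ci (RtoC (-1))))
    (path_mul (segment (RtoC (-1)) (- Ci)%C) (segment (- Ci)%C (RtoC 1))).

(** The Euclidean scalar product. Its positivity for the points of the square and of the circle at
    the same parameter keeps the straight homotopy between them away from the centre. *)
Definition inner (z w : C) : R := fst z * fst w + snd z * snd w.

Lemma inner_chord t :
  0 <= t <= 1 -> 0 < (1 - t) * cos (PI / 2 * t) + t * sin (PI / 2 * t).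
Proof.
intros Ht; assert (P := PI_RGT_0).
assert (0 <= sin (PI / 2 * t)) by (apply sin_ge_0; nra).
assert (0 <= cos (PI / 2 * t)) by (apply cos_ge_0; nra).
destruct (Rle_lt_or_eq_dec t 1 (proj2 Ht)) as [L| ->].
- assert (0 < cos (PI / 2 * t)) by (apply cos_gt_0; nra).
  assert (0 < (1 - t) * cos (PI / 2 * t)) by (apply Rmult_lt_0_compat; lra).
  assert (0 <= t * sin (PI / 2 * t)) by (apply Rmult_le_pos; lra).
  lra.
- rewrite Rmult_1_r, sin_PI2, cos_PI2; lra.
Qed.

Lemma cos_quarters x :
  (cos (x + PI / 2) = - sin x /\ sin (x + PI / 2) = cos x) /\
  (cos (x + PI) = - cos x /\ sin (x + PI) = - sin x) /\
  (cos (x + (PI + PI / 2)) = sin x /\ sin (x + (PI + PI / 2)) = - cos x).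
Proof.
assert (A : forall x, cos (x + PI / 2) = - sin x /\ sin (x + PI / 2) = cos x).
{ intros y; rewrite cos_plus, sin_plus, cos_PI2, sin_PI2; split; ring. }
repeat split; try apply A; try apply neg_cos; try apply neg_sin;
rewrite <- Rplus_assoc; [rewrite (proj1 (A _)), neg_sin|rewrite (proj2 (A _)), neg_cos];
ring.
Qed.

Lemma unit_square_spec s :
  I01 s -> 0 < inner (unit_square s) (expi (2 * PI * s)) /\ Cmod (unit_square s) <= 1.
Proof.
intros [H0 H1].
assert (B : forall t a b, 0 <= t <= 1 -> Cmod a = 1 -> Cmod b = 1 -> Cmod (segment a b t) <= 1).
{ intros t a b Ht Ha Hb; unfold segment.
  replace (a + RtoC t * (b - a))%C with (RtoC (1 - t) * a + RtoC t * b)%C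
    by (rewrite RtoC_minus; ring).
  eapply Rle_trans; [apply Cmod_triangle|].
  rewrite !Cmod_mult, !Cmod_R, Ha, Hb, !Rabs_pos_eq by lra; lra. }
assert (C1 : Cmod (RtoC 1) = 1) by (rewrite Cmod_R, Rabs_R1; reflexivity).
assert (C2 : Cmod (RtoC (-1)) = 1) by (rewrite Cmod_R, Rabs_left; lra).
assert (C3 : Cmod Ci = 1).
{ unfold Cmod, Ci; simpl; replace (0 * (0 * 1) + 1 * (1 * 1)) with 1 by ring.
  apply sqrt_1. }
assert (C4 : Cmod (- Ci)%C = 1) by (now rewrite Cmod_opp).
unfold unit_square, path_mul.
destruct (Rle_dec s (1 / 2)); [destruct (Rle_dec (2 * s) (1 / 2))|
  destruct (Rle_dec (2 * s - 1) (1 / 2))].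
- split; [|apply B; auto; lra].
  set (t := 2 * (2 * s)); assert (Ht : 0 <= t <= 1) by (unfold t; lra).
  replace (2 * PI * s) with (PI / 2 * t) by (unfold t; field).
  replace (inner _ _) with ((1 - t) * cos (PI / 2 * t) + t * sin (PI / 2 * t));
  [now apply inner_chord|].
  unfold inner, segment, expi, Ci; simpl; ring.
- split; [|apply B; auto; lra].
  set (t := 2 * (2 * s) - 1); assert (Ht : 0 <= t <= 1) by (unfold t; lra).
  replace (2 * PI * s) with (PI / 2 * t + PI / 2) by (unfold t; field).
  replace (inner _ _) with ((1 - t) * cos (PI / 2 * t) + t * sin (PI / 2 * t));
  [now apply inner_chord|].
  destruct (cos_quarters (PI / 2 * t)) as ((Ec & Es) & _).
  unfold inner, segment, expi, Ci; simpl; rewrite Ec, Es; ring.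
- split; [|apply B; auto; lra].
  set (t := 2 * (2 * s - 1)); assert (Ht : 0 <= t <= 1) by (unfold t; lra).
  replace (2 * PI * s) with (PI / 2 * t + PI) by (unfold t; field).
  replace (inner _ _) with ((1 - t) * cos (PI / 2 * t) + t * sin (PI / 2 * t));
  [now apply inner_chord|].
  destruct (cos_quarters (PI / 2 * t)) as (_ & (Ec & Es) & _).
  unfold inner, segment, expi, Ci; simpl; rewrite Ec, Es; ring.
- split; [|apply B; auto; lra].
  set (t := 2 * (2 * s - 1) - 1); assert (Ht : 0 <= t <= 1) by (unfold t; lra).
  replace (2 * PI * s) with (PI / 2 * t + (PI + PI / 2)) by (unfold t; field).
  replace (inner _ _) with ((1 - t) * cos (PI / 2 * t) + t * sin (PI / 2 * t));
  [now apply inner_chord|].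
  destruct (cos_quarters (PI / 2 * t)) as (_ & _ & (Ec & Es)).
  unfold inner, segment, expi, Ci; simpl; rewrite Ec, Es; ring.
Qed.

Lemma Cmod_expi x : Cmod (expi x) = 1.
Proof.
unfold Cmod, expi; simpl.
rewrite !Rmult_1_r; fold (Rsqr (cos x)) (Rsqr (sin x)).
rewrite Rplus_comm, sin2_cos2; apply sqrt_1.
Qed.

Lemma model_point_real i : exists x, model_point i = RtoC x /\ -3 <= x <= 3.
Proof.
do 6 (destruct i as [|i]; [simpl; eexists; split; [reflexivity|lra]|]).
simpl; eexists; split; [reflexivity|lra].
Qed.

Lemma model_point_apart i j :
  model_point i = model_point j \/ 1 / 2 <= Cmod (model_point i - model_point j)%C.
Proof.
assert (A : forall x y : R, x = y \/ 1 / 2 <= Rabs (x - y) ->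
  RtoC x = RtoC y \/ 1 / 2 <= Cmod (RtoC x - RtoC y)%C).
{ intros x y [->|H]; [now left|right].
  now rewrite <- RtoC_minus, Cmod_R. }
do 6 (destruct i as [|i]; [do 6 (destruct j as [|j];
  [apply A; unfold Rabs; destruct (Rcase_abs _); lra|]);
  apply A; unfold Rabs; destruct (Rcase_abs _); lra|]).
do 6 (destruct j as [|j];
  [apply A; unfold Rabs; destruct (Rcase_abs _); lra|]);
apply A; unfold Rabs; destruct (Rcase_abs _); lra.
Qed.

Section Lasso.

Variables (i : nat).

Let p : C := model_point i.
Let d : C := (u0 - p)%C.

Lemma lasso_direction : 4 <= Cmod d <= 5.
Proof.
destruct (model_point_real i) as (x & E & Hx).
unfold d, p; rewrite E; unfold Cmod, u0, Ci; simpl.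
match goal with |- _ <= sqrt ?a <= _ => replace a with (x * x + 16) by ring end.
rewrite <- (sqrt_square 4) at 1 by lra; rewrite <- (sqrt_square 5) by lra.
split; apply sqrt_le_1_alt; nra.
Qed.

Lemma ray_in k : 0 < k <= 1 -> avoid model_set (p + RtoC k * d)%C.
Proof.
intros Hk; destruct (model_point_real i) as (x & E & Hx); split.
- unfold disk.
  replace (p + RtoC k * d)%C with (RtoC (1 - k) * p + RtoC k * u0)%C
    by (unfold d; rewrite RtoC_minus; ring).
  eapply Rle_trans; [apply Cmod_triangle|].
  rewrite !Cmod_mult, u0_boundary, !Cmod_R, !Rabs_pos_eq by lra.
  unfold p; rewrite E, Cmod_R.
  assert (Rabs x <= 3) by (apply Rabs_le; lra).
  assert ((1 - k) * Rabs x <= (1 - k) * 3) by (apply Rmult_le_compat_l; lra).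
  lra.
- intros (j & _ & Ej); destruct (model_point_real j) as (y & E' & _).
  rewrite E' in Ej; apply (f_equal snd) in Ej; revert Ej.
  unfold d, p; rewrite E; unfold u0, Ci; simpl; lra.
Qed.

Lemma near_in z : z <> RtoC 0 -> Cmod (d * z)%C < 1 / 2 -> avoid model_set (p + d * z)%C.
Proof.
intros Hz Hd; assert (L := lasso_direction); split.
- unfold disk; eapply Rle_trans; [apply Cmod_triangle|].
  destruct (model_point_real i) as (x & E & Hx).
  unfold p; rewrite E, Cmod_R.
  assert (Rabs x <= 3) by (apply Rabs_le; lra); lra.
- intros (j & _ & Ej).
  assert (E : (model_point j - model_point i = d * z)%C) by (rewrite Ej; unfold p; ring).
  destruct (model_point_apart j i) as [EQ|A].
  + rewrite EQ in E.
    apply (Cmult_neq_0 d z); [|exact Hz|rewrite <- E; apply Cplus_opp_r].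
    intros E0; rewrite E0, Cmod_0 in L; lra.
  + rewrite E in A; lra.
Qed.

Variable r : R.
Hypothesis Hr : 0 < r < 1 / 2.

Let rho : R := r / Cmod d.
Let e : C := (p + RtoC r * ((u0 - p) / RtoC (Cmod (u0 - p))))%C.
Let c : R := 2 / 25.
Let e' : C := (p + RtoC c * d)%C.

Lemma rho_spec : 0 < rho /\ rho * Cmod d < 1 / 2 /\ rho <= 1.
Proof.
assert (L := lasso_direction); unfold rho; repeat split.
- apply Rdiv_lt_0_compat; lra.
- unfold Rdiv; rewrite Rmult_assoc, Rinv_l; lra.
- apply Rmult_le_reg_r with (Cmod d); [lra|].
  unfold Rdiv; rewrite Rmult_assoc, Rinv_l; lra.
Qed.

Lemma e_eq : e = (p + RtoC rho * d)%C.
Proof.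
assert (L := lasso_direction).
unfold e, rho; fold d; rewrite RtoC_div by lra; unfold Cdiv; ring.
Qed.

Let squared : path :=
  path_mul (path_mul (segment u0 e') (fun s => (p + RtoC c * d * unit_square s)%C))
    (segment e' u0).

Lemma inner_expi_self x : inner (expi x) (expi x) = 1.
Proof.
unfold inner, expi; simpl; generalize (sin2_cos2 x); unfold Rsqr; lra.
Qed.

(** Seen from [p] and divided by [d], the interpolated point has a positive scalar product with the
    point of the unit circle at [s], so it differs from [p]; being closer than 1/2 to [p], it is no
    other model point either. *)
Lemma circle_square_in t s :
  I01 t -> I01 s ->
  avoid model_set ((1 - RtoC t) * circle p e s +
    RtoC t * (p + RtoC c * d * unit_square s))%C.
Proof.
intros [T0 T1] Hs; destruct (unit_square_spec s Hs) as [HI HM].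
destruct rho_spec as (R0 & R1 & _); assert (L := lasso_direction).
set (E := expi (2 * PI * s)) in *.
set (z := (RtoC ((1 - t) * rho) * E + RtoC (t * c) * unit_square s)%C).
replace ((1 - RtoC t) * circle p e s + RtoC t * (p + RtoC c * d * unit_square s))%C
  with (p + d * z)%C.
2:{ unfold z, circle; fold E; rewrite e_eq, !RtoC_mult, RtoC_minus; ring. }
assert (Hc : c * Cmod d < 1 / 2) by (unfold c; lra).
apply near_in.
- intros Z.
  assert (K : inner z E = (1 - t) * rho * inner E E + t * c * inner (unit_square s) E)
    by (unfold inner, z; simpl; ring).
  assert (K0 : inner z E = 0) by (rewrite Z; unfold inner; simpl; ring).
  unfold E at 2 3 in K; rewrite inner_expi_self in K; fold E in K.
  rewrite K0 in K.
  assert (0 < c * inner (unit_square s) E) by (apply Rmult_lt_0_compat; [unfold c; lra|exact HI]).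
  destruct (Rle_lt_or_eq_dec 0 t T0) as [T|T]; [|subst t; lra].
  assert (0 < t * (c * inner (unit_square s) E)) by (now apply Rmult_lt_0_compat).
  assert (0 <= (1 - t) * rho) by (apply Rmult_le_pos; lra).
  lra.
- rewrite Cmod_mult.
  assert (B : Cmod z <= (1 - t) * rho + t * c).
  { unfold z; eapply Rle_trans; [apply Cmod_triangle|].
    assert (0 <= (1 - t) * rho) by (apply Rmult_le_pos; lra).
    assert (0 <= t * c) by (apply Rmult_le_pos; unfold c; lra).
    rewrite !Cmod_mult, !Cmod_R, !Rabs_pos_eq by assumption.
    unfold E; rewrite Cmod_expi.
    assert (t * c * Cmod (unit_square s) <= t * c * 1) by (now apply Rmult_le_compat_l).
    lra. }
  apply Rle_lt_trans with (Cmod d * ((1 - t) * rho + t * c));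
  [apply Rmult_le_compat_l; lra|].
  replace (Cmod d * ((1 - t) * rho + t * c)) with
    ((1 - t) * (rho * Cmod d) + t * (c * Cmod d)) by ring.
  destruct (Rle_lt_or_eq_dec t 1 T1) as [T|T]; [|subst t; lra].
  assert ((1 - t) * (rho * Cmod d) < (1 - t) * (1 / 2)) by (apply Rmult_lt_compat_l; lra).
  assert (t * (c * Cmod d) <= t * (1 / 2)) by (apply Rmult_le_compat_l; lra).
  lra.
Qed.

(** Both segments lie on the ray from [p] through [u0], and so does every interpolated point,
    strictly below the real axis. *)
Lemma legs_in t s k : I01 t -> I01 s -> 0 < k <= 1 ->
  avoid model_set ((1 - RtoC t) * segment u0 e s +
    RtoC t * segment u0 (p + RtoC k * d) s)%C.
Proof.
intros [T0 T1] [S0 S1] Hk; destruct rho_spec as (R0 & _ & R1).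
replace ((1 - RtoC t) * segment u0 e s + RtoC t * segment u0 (p + RtoC k * d) s)%C
  with (p + RtoC ((1 - t) * (1 - s * (1 - rho)) + t * (1 - s * (1 - k))) * d)%C.
2:{ unfold segment; rewrite e_eq.
  replace u0 with (p + d)%C at 1 2 3 4 by (unfold d; ring).
  rewrite !RtoC_plus, !RtoC_mult, !RtoC_minus, !RtoC_mult, !RtoC_minus; ring. }
assert (A : forall k, 0 < k <= 1 -> 0 < 1 - s * (1 - k) <= 1) by (intros; nra).
apply ray_in; destruct (A rho) as [A1 A2], (A k) as [A3 A4]; try lra.
split; [|nra].
destruct (Rle_lt_or_eq_dec 0 t T0) as [T|T]; [|subst t; lra].
assert (0 < t * (1 - s * (1 - k))) by (now apply Rmult_lt_0_compat).
assert (0 <= (1 - t) * (1 - s * (1 - rho))) by (apply Rmult_le_pos; lra).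
lra.
Qed.

Lemma continuous_on_mul a b :
  continuous_on I01 a -> continuous_on I01 b -> a 1 = b 0 ->
  continuous_on I01 (path_mul a b).
Proof.
intros Ha Hb E.
apply (path_in_mul (fun _ => True) (a 0) (a 1) (b 1)); repeat split; auto.
Qed.

Lemma continuous_segment a b : continuous_on I01 (segment a b).
Proof. apply continuous_on_forall; intros s _; apply continuous_C; simpl; cont. Qed.

Lemma lasso_squared : hom (avoid model_set) u0 u0 (lasso r p) squared.
Proof.
assert (HX : forall t s, I01 t -> I01 s ->
  avoid model_set ((1 - RtoC t) * lasso r p s + RtoC t * squared s)%C).
{ intros t s Ht Hs; unfold lasso, squared, path_mul; fold e.
  destruct (Rle_dec s (1 / 2)); [destruct (Rle_dec (2 * s) (1 / 2))|].
  - apply legs_in; unfold I01, c in *; lra.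
  - apply circle_square_in; unfold I01 in *; lra.
  - replace (segment e u0 (2 * s - 1)) with (segment u0 e (1 - (2 * s - 1)))
      by (now rewrite <- (segment_inv u0 e)).
    replace (segment e' u0 (2 * s - 1)) with (segment u0 e' (1 - (2 * s - 1)))
      by (now rewrite <- (segment_inv u0 e')).
    apply legs_in; unfold I01, c in *; lra. }
assert (E1 : expi (2 * PI * 1) = RtoC 1).
{ unfold expi; rewrite Rmult_1_r, cos_2PI, sin_2PI; reflexivity. }
assert (E0 : expi (2 * PI * 0) = RtoC 1).
{ unfold expi; rewrite Rmult_0_r, cos_0, sin_0; reflexivity. }
assert (Q0 : unit_square 0 = RtoC 1).
{ unfold unit_square; now rewrite !path_mul_0, segment_0. }
assert (Q1 : unit_square 1 = RtoC 1).
{ unfold unit_square; now rewrite !path_mul_1, segment_1. }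
apply hom_straight; [| |exact HX]; (split; [|split; [|split]]).
- unfold lasso; fold e; apply continuous_on_mul; [apply continuous_on_mul| |].
  + apply continuous_segment.
  + apply continuous_on_forall; intros s _; apply continuous_C; simpl; cont.
  + rewrite segment_1; unfold circle; rewrite E0.
    change (e = p + (e - p) * RtoC 1)%C; ring.
  + apply continuous_segment.
  + rewrite path_mul_1, segment_0; unfold circle; rewrite E1.
    change (p + (e - p) * RtoC 1 = e)%C; ring.
- intros s Hs; replace (lasso r p s) with
    ((1 - RtoC 0) * lasso r p s + RtoC 0 * squared s)%C by ring.
  apply HX; [apply I01_0|exact Hs].
- unfold lasso; rewrite !path_mul_0; apply segment_0.
- unfold lasso; rewrite !path_mul_1; apply segment_1.
- assert (CQ : continuous_on I01 unit_square).
  { unfold unit_square; apply continuous_on_mul; [apply continuous_on_mul|apply continuous_on_mul|];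
    first [apply continuous_segment|now rewrite ?path_mul_0, ?path_mul_1, ?segment_0, ?segment_1]. }
  destruct (extend_path _ CQ) as (q & Hq & Eq).
  unfold squared; apply continuous_on_mul; [apply continuous_on_mul| |].
  + apply continuous_segment.
  + apply continuous_on_ext with (fun s => (p + RtoC c * d * q s)%C).
    * intros s Hs; now rewrite Eq.
    * apply continuous_on_forall; intros s _; apply continuous_C; simpl; cont.
  + rewrite segment_1, Q0.
    change (e' = p + RtoC c * d * RtoC 1)%C; unfold e'; ring.
  + apply continuous_segment.
  + rewrite path_mul_1, segment_0, Q1.
    change (p + RtoC c * d * RtoC 1 = e')%C; unfold e'; ring.
- intros s Hs; replace (squared s) with
    ((1 - RtoC 1) * lasso r p s + RtoC 1 * squared s)%C by ring.
  apply HX; [apply I01_1|exact Hs].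
- unfold squared; rewrite !path_mul_0; apply segment_0.
- unfold squared; rewrite !path_mul_1; apply segment_1.
Qed.

(** The affine map [w -> p + c d w] carries segments to segments, and the rest is reassociation. *)
Lemma squared_polygon X v0 v1 v2 v3 :
  edges_in X (loop_at base [v0; v1; v2; v3; v0]) ->
  vtx v0 = (p + RtoC c * d * RtoC 1)%C -> vtx v1 = (p + RtoC c * d * Ci)%C ->
  vtx v2 = (p + RtoC c * d * RtoC (-1))%C -> vtx v3 = (p + RtoC c * d * (- Ci))%C ->
  hom X u0 u0 squared (polygon (loop_at base [v0; v1; v2; v3; v0])).
Proof.
intros HE E0 E1 E2 E3.
assert (S : forall a b, image (fun w => p + RtoC c * d * w)%C (segment a b) =
  segment (p + RtoC c * d * a)%C (p + RtoC c * d * b)%C).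
{ intros a b; apply functional_extensionality; intros s.
  unfold image, segment; ring. }
unfold squared.
change (fun s => (p + RtoC c * d * unit_square s)%C) with
  (image (fun w => p + RtoC c * d * w)%C unit_square).
unfold unit_square; rewrite !image_mul, !S, <- E0, <- E1, <- E2, <- E3.
replace e' with (vtx v0) by (rewrite E0; unfold e'; ring).
cbn [loop_at app polygon]; cbn [loop_at app edges_in] in HE.
destruct HE as (H0 & H1 & H2 & H3 & H4 & H5 & _).
apply segment_path_in in H0, H1, H2, H3, H4, H5.
rewrite vtx_base in *.
apply hom_trans with (path_mul (path_mul (segment u0 (vtx v0))
  (path_mul (segment (vtx v0) (vtx v1)) (path_mul (segment (vtx v1) (vtx v2))
    (path_mul (segment (vtx v2) (vtx v3)) (segment (vtx v3) (vtx v0))))))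
  (segment (vtx v0) u0)).
- eapply hom_mul; [|exact (hom_refl _ _ _ _ H5)].
  eapply hom_mul; [exact (hom_refl _ _ _ _ H0)|].
  apply (hom_assoc _ _ _ _ _ _ _ _ H1 H2 (path_in_mul _ _ _ _ _ _ H3 H4)).
- eapply hom_trans.
  { apply (hom_assoc _ _ _ _ _ _ _ _ H0
      (path_in_mul _ _ _ _ _ _ H1 (path_in_mul _ _ _ _ _ _ H2 (path_in_mul _ _ _ _ _ _ H3 H4))) H5). }
  eapply hom_mul; [exact (hom_refl _ _ _ _ H0)|].
  eapply hom_trans.
  { apply (hom_assoc _ _ _ _ _ _ _ _ H1
      (path_in_mul _ _ _ _ _ _ H2 (path_in_mul _ _ _ _ _ _ H3 H4)) H5). }
  eapply hom_mul; [exact (hom_refl _ _ _ _ H1)|].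
  eapply hom_trans.
  { apply (hom_assoc _ _ _ _ _ _ _ _ H2 (path_in_mul _ _ _ _ _ _ H3 H4) H5). }
  eapply hom_mul; [exact (hom_refl _ _ _ _ H2)|].
  eapply hom_trans; [apply (hom_assoc _ _ _ _ _ _ _ _ H3 H4 H5)|].
  eapply hom_mul; [exact (hom_refl _ _ _ _ H3)|].
  eapply hom_mul; [exact (hom_refl _ _ _ _ H4)|].
  apply hom_sym, hom_1r, H5.
Qed.

End Lasso.

(** * Polygons avoiding the motion that defines the g-base *)

Definition point_region (v : vertex) : region := (v, v, v).

Lemma in_point_region v p : p = vtx v -> in_region p (point_region v).
Proof.
intros ->; exists 0, 0; repeat split; try lra.
unfold combination; rewrite !RtoC_minus; ring.
Qed.

Lemma covers_indexed (rho : nat -> region) (f : nat -> C) :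
  (forall i, (1 <= i <= 6)%nat -> in_region (f i) (rho i)) ->
  covers (map rho (List.seq 1 6)) (fun y => exists i, (1 <= i <= 6)%nat /\ f i = y).
Proof.
intros H y (i & Hi & <-); exists (rho i); split; [|now apply H].
apply in_map, in_seq; lia.
Qed.

Ltac split_index i := destruct i as [|[|[|[|[|[|[|i]]]]]]]; try (exfalso; lia).

Definition model_region (r5 r6 : region) (i : nat) : region :=
  match i with
  | 1%nat => point_region (-100, 0)
  | 2%nat => point_region (-50, 0)
  | 3%nat => point_region (0, 0)
  | 4%nat => point_region (100, 0)
  | 5%nat => r5
  | _ => r6
  end%Z.

Definition model_regions (r5 r6 : region) : list region :=
  map (model_region r5 r6) (List.seq 1 6).

Definition start_regions : list region :=
  model_regions (point_region (200, 0)%Z) (point_region (300, 0)%Z).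

Ltac vtx_eq := apply injective_projections; unfold vtx, u0; simpl; lra.

Lemma start_regions_cover : covers start_regions model_set.
Proof.
apply covers_indexed; intros i Hi.
split_index i; apply in_point_region; vtx_eq.
Qed.

Lemma lasso_loop_clear i : loop_clear start_regions base (lasso_loop i) = true.
Proof. destruct i as [|[|[|[|[|[|[|i]]]]]]]; vm_compute; reflexivity. Qed.

Lemma lasso_polygon r i : 0 < r < 1 / 2 ->
  hom (avoid model_set) u0 u0 (lasso r (model_point i))
    (polygon (loop_at base (lasso_loop i))).
Proof.
intros Hr; eapply hom_trans; [apply lasso_squared, Hr|].
assert (H := loop_clear_edges _ _ _ start_regions_cover _ (lasso_loop_clear i)).
destruct i as [|[|[|[|[|[|[|i]]]]]]]; apply squared_polygon;
try exact H; cbn [model_point]; vtx_eq.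
Qed.

(** Loops 5 and 6 enclose the whole tracks of the moving points, from 2 to -i and from 3 to i. Loops
    3 and 4 reach their points on the left of -i, since the track of the fifth point ends with the
    segment from 5/2 - i to -i. *)
Definition standard_loop (j : nat) : list vertex :=
  match j with
  | 1%nat => [(-120, -20); (-80, -20); (-80, 20); (-120, 20); (-120, -20)]
  | 2%nat => [(-65, -15); (-35, -15); (-35, 15); (-65, 15); (-65, -15)]
  | 3%nat => [(-25, -90); (-20, -20); (20, -20); (20, 20); (-20, 20); (-20, -20);
      (-25, -90)]
  | 4%nat => [(-20, -60); (80, -20); (120, -20); (120, 20); (80, 20); (80, -20);
      (-20, -60)]
  | 5%nat => [(-20, -120); (270, -120); (270, -40); (220, 20); (180, 20);
      (180, -80); (-20, -80); (-20, -120)]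
  | _ => [(300, -100); (280, -20); (320, -20); (320, 120); (-20, 120); (-20, 80);
      (230, 80); (230, 40); (280, -20); (300, -100)]
  end%Z.

(** The quarter circles of the rotation lie in the right triangles formed by their chord and the
    tangents at their ends; the straight moves give degenerate triangles. *)
Definition model_stage (k : nat) : list region :=
  match k with
  | 0%nat => model_regions ((200, -50), (200, 0), (250, -50))
                           ((300, 50), (300, 0), (250, 50))
  | 1%nat => model_regions ((250, -50), (250, -100), (250, -100))
                           ((250, 50), (250, 100), (250, 100))
  | _ => model_regions ((250, -100), (0, -100), (0, -100))
                       ((250, 100), (0, 100), (0, 100))
  end%Z.

Lemma quarter_circle a : 0 <= a <= PI / 2 ->
  0 <= cos a <= 1 /\ 0 <= sin a <= 1 /\ 1 <= cos a + sin a.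
Proof.
intros Ha; assert (P := PI_RGT_0).
assert (0 <= sin a) by (apply sin_ge_0; lra).
assert (0 <= cos a) by (apply cos_ge_0; lra).
assert (Q := sin2_cos2 a); unfold Rsqr in Q.
repeat split; nra.
Qed.

Lemma model_stage_cover t : I01 t -> exists k, (k <= 2)%nat /\
  covers (model_stage k) (fun y => exists i, (1 <= i <= 6)%nat /\ model_motion i t = y).
Proof.
intros [T0 T1]; assert (P := PI_RGT_0).
destruct (Rle_dec t (1 / 3)) as [L|L]; [|destruct (Rle_dec t (2 / 3)) as [L'|L']].
- exists 0%nat; split; [lia|]; apply covers_indexed; intros i Hi.
  assert (Q := quarter_circle (PI / 2 * (3 * t)) ltac:(nra)).
  split_index i; try (apply in_point_region; vtx_eq);
  (* The corner at the right angle comes first, so the two weights are read off the coordinates;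
     that their sum is at most 1 means [1 <= cos + sin]. *)
  exists (1 - sin (PI / 2 * (3 * t))), (1 - cos (PI / 2 * (3 * t)));
  (repeat split; [lra|lra|lra|]);
  unfold model_motion, pair_center, pair_offset;
  (destruct (Rle_dec t (2 / 3)); [|lra]); (destruct (Rle_dec t (1 / 3)); [|lra]);
  apply injective_projections; unfold combination, vtx, expi; simpl; field.
- exists 1%nat; split; [lia|]; apply covers_indexed; intros i Hi.
  split_index i; try (apply in_point_region; vtx_eq);
  exists (3 * t - 1), 0; (repeat split; [lra|lra|lra|]);
  unfold model_motion, pair_center, pair_offset;
  (destruct (Rle_dec t (2 / 3)); [|lra]); (destruct (Rle_dec t (1 / 3)); [lra|]);
  apply injective_projections; unfold combination, vtx, Ci; simpl; field.
- exists 2%nat; split; [lia|]; apply covers_indexed; intros i Hi.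
  split_index i; try (apply in_point_region; vtx_eq);
  exists (3 * t - 2), 0; (repeat split; [lra|lra|lra|]);
  unfold model_motion, pair_center, pair_offset;
  (destruct (Rle_dec t (2 / 3)); [lra|]); (destruct (Rle_dec t (1 / 3)); [lra|]);
  apply injective_projections; unfold combination, vtx, Ci; simpl; field.
Qed.

Lemma standard_loop_clear k j : (k <= 2)%nat ->
  loop_clear (model_stage k) base (standard_loop j) = true.
Proof.
intros Hk; destruct k as [|[|[|k]]]; [| | |lia];
destruct j as [|[|[|[|[|[|[|j]]]]]]]; vm_compute; reflexivity.
Qed.

Lemma lasso_standard j :
  homotopic_check start_regions base (lasso_loop j) (standard_loop j) = true.
Proof. destruct j as [|[|[|[|[|[|[|j]]]]]]]; vm_compute; reflexivity. Qed.

Definition standard (j : nat) : path := polygon (loop_at base (standard_loop j)).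

Lemma model_motion_0 i : model_motion i 0 = model_point i.
Proof.
destruct i as [|[|[|[|[|[|[|i]]]]]]]; try reflexivity;
unfold model_motion, pair_center, pair_offset;
(destruct (Rle_dec 0 (2 / 3)); [|lra]); (destruct (Rle_dec 0 (1 / 3)); [|lra]);
rewrite !Rmult_0_r; apply injective_projections; unfold expi;
simpl; rewrite ?sin_0, ?cos_0; lra.
Qed.

Lemma K_model y : K y -> exists i, (1 <= i <= 6)%nat /\ model_motion i 1 = y.
Proof.
unfold K; intros H; simpl in H.
assert (E : model_motion 5 1 = (- Ci)%C /\ model_motion 6 1 = Ci).
{ unfold model_motion, pair_center, pair_offset.
  destruct (Rle_dec 1 (2 / 3)); [lra|]; destruct (Rle_dec 1 (1 / 3)); [lra|].
  split; apply injective_projections; simpl; lra. }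
destruct H as [H|[H|[H|[H|[H|[H|[]]]]]]]; subst y.
- exists 1%nat; split; [lia|reflexivity].
- exists 2%nat; split; [lia|reflexivity].
- exists 3%nat; split; [lia|reflexivity].
- exists 4%nat; split; [lia|reflexivity].
- exists 6%nat; split; [lia|apply E].
- exists 5%nat; split; [lia|apply E].
Qed.

Lemma image_cancel X u v f g (D : C -> Prop) a :
  path_in X u v a -> (forall s, I01 s -> D (a s)) -> (forall z, D z -> f (g z) = z) ->
  hom X u v (image f (image g a)) a.
Proof.
intros Ha HD Hfg; eapply hom_ext; [apply hom_refl, Ha| |reflexivity].
intros s Hs; unfold image; now rewrite Hfg; auto.
Qed.

Lemma avoid_disk P u v a : path_in (avoid P) u v a -> forall s, I01 s -> disk (a s).
Proof. intros (_ & H & _) s Hs; now apply H. Qed.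

(** The loop [standard j] avoids the motion at all times, so its pull-back by [G 1] is still in the
    class of the lasso; pushing forward by [F 1] gives the claim. The classes of the g-base
    therefore depend neither on [r] nor on [psi]. *)
Lemma gbase_standard r psi j :
  0 < r < 1 / 2 -> induces 6 model_motion psi ->
  hom punctured_disk u0 u0 (gbase psi r j) (standard j).
Proof.
intros Hr (F & HF & Epsi).
destruct (realizes_isotopy _ _ _ HF) as [G FG].
destruct HF as (_ & _ & _ & _ & HF).
assert (HM : forall t y, I01 t -> moved model_set (F t) y ->
  exists i, (1 <= i <= 6)%nat /\ model_motion i t = y).
{ intros t y It (p & (i & Hi & <-) & <-); exists i; split; [exact Hi|].
  now rewrite <- HF, model_motion_0. }
assert (HS : forall t, I01 t -> path_in (avoid (moved model_set (F t))) u0 u0 (standard j)).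
{ intros t It; destruct (model_stage_cover t It) as (k & Hk & Hc).
  rewrite <- vtx_base; apply (loop_clear_path_in (model_stage k)).
  - intros y Hy; now apply Hc, HM.
  - now apply standard_loop_clear. }
assert (I0 := I01_0); assert (I1 := I01_1); assert (U := u0_boundary).
assert (D : forall s, I01 s -> disk (standard j s)) by apply (avoid_disk _ _ _ _ (HS 0 I0)).
assert (H : hom (avoid model_set) u0 u0 (lasso r (model_point j)) (image (G 1) (standard j))).
{ eapply hom_trans; [apply lasso_polygon, Hr|].
  apply hom_trans with (standard j).
  - rewrite <- vtx_base; apply (homotopic_check_sound start_regions);
    [apply start_regions_cover|apply lasso_standard].
  - eapply hom_ext; [apply (transport_still F G FG model_set u0 U 0 1); auto; lra| |reflexivity].
    intros s Hs; now apply iso_inv_0 with F; auto. }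
apply (push_hom F G FG _ u0) with (t := 1) in H; auto.
2:{ intros p (i & _ & <-); destruct (model_point_real i) as (x & -> & Hx).
  unfold disk; rewrite Cmod_R; apply Rabs_le; lra. }
apply (hom_mono _ punctured_disk) in H.
2:{ intros z [Dz Hz]; split; [exact Dz|]; intros Kz; apply Hz.
  destruct (K_model z Kz) as (i & Hi & <-).
  exists (model_point i); split; [now exists i|].
  rewrite <- model_motion_0; now apply HF. }
eapply hom_ext; [exact H| |].
- intros s Hs; unfold gbase, image; symmetry; apply Epsi.
  assert (L := lasso_polygon r j Hr); apply hom_path_l in L.
  now apply (avoid_disk _ _ _ _ L).
- intros s Hs; unfold image; apply FG; auto.
Qed.

(** * The local braid monodromy *)

(* The fiber of the curve over [w * w]. *)
Definition fiber (w y : C) : Prop :=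
  y = RtoC 0 \/ y = (- (w * w) / 2)%C \/
  exists n, (n < 4)%nat /\ y = Nat.iter n quarter w.

Lemma Cmult_eq_0 a b : (a * b = 0)%C -> a = RtoC 0 \/ b = RtoC 0.
Proof.
intros H; apply NNPP; intros N.
apply (Cmult_neq_0 a b); tauto.
Qed.

(** With [x = w * w] the quadratic factors split: [y^2 - x] into [(y - w) (y + w)] and [y^2 + x]
    into [(y - i w) (y + i w)]. *)
Lemma curve_fiber t y : curve (expi (2 * PI * t)) y -> fiber (expi (PI * t)) y.
Proof.
intros (_ & _ & H).
set (w := expi (PI * t)).
assert (E : expi (2 * PI * t) = (w * w)%C).
{ unfold w, expi; replace (2 * PI * t) with (2 * (PI * t)) by ring.
  rewrite cos_2a, sin_2a; apply injective_projections; simpl; ring. }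
rewrite E in H; unfold fiber.
assert (I2 : (Ci * Ci = - 1)%C) by (apply injective_projections; simpl; ring).
apply Cmult_eq_0 in H; destruct H as [H|H];
[apply Cmult_eq_0 in H; destruct H as [H|H];
 [apply Cmult_eq_0 in H; destruct H as [H|H]|]|].
- now left.
- right; left.
  replace y with ((w * w + 2 * y - w * w) / 2)%C
    by (field; intros K; apply RtoC_inj in K; lra).
  rewrite H; unfold Cdiv; ring.
- right; right.
  assert (H' : ((y - Ci * w) * (y + Ci * w) = 0)%C).
  { rewrite <- H; transitivity (y * y - (Ci * Ci) * (w * w))%C; [ring|].
    rewrite I2; ring. }
  apply Cmult_eq_0 in H'; destruct H' as [H'|H'].
  + exists 1%nat; split; [lia|]; simpl; unfold quarter.
    replace y with (y - Ci * w + Ci * w)%C by ring; rewrite H'; ring.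
  + exists 3%nat; split; [lia|]; simpl; unfold quarter.
    replace y with (y + Ci * w - Ci * w)%C by ring; rewrite H'.
    transitivity ((Ci * Ci) * (Ci * w))%C; [rewrite I2|]; ring.
- right; right.
  assert (H' : ((y - w) * (y + w) = 0)%C) by (rewrite <- H; ring).
  apply Cmult_eq_0 in H'; destruct H' as [H'|H'].
  + exists 0%nat; split; [lia|]; simpl.
    replace y with (y - w + w)%C by ring; rewrite H'; ring.
  + exists 2%nat; split; [lia|]; simpl; unfold quarter.
    replace y with (y + w - w)%C by ring; rewrite H'.
    transitivity ((Ci * Ci) * w)%C; [rewrite I2|]; ring.
Qed.

Lemma K_fiber z : K z -> curve (RtoC 1) z.
Proof.
assert (D : forall z, fst z * fst z + snd z * snd z <= 1 -> disk z).
{ intros y Hy; unfold disk, Cmod; rewrite <- (sqrt_square 4) by lra.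
  apply sqrt_le_1_alt; simpl; lra. }
intros H; split; [rewrite Cmod_R, Rabs_R1; lra|].
unfold K in H; simpl in H.
destruct H as [H|[H|[H|[H|[H|[H|[]]]]]]]; subst z;
(split; [apply D; simpl; lra|apply injective_projections; simpl; field]).
Qed.

(** * Triangles covering the fiber during each eighth of a turn of w *)

Definition rot_vertex (v : vertex) : vertex := (- snd v, fst v)%Z.

Definition rot (r : region) : region :=
  let '(a, b, c) := r in (rot_vertex a, rot_vertex b, rot_vertex c).

Lemma in_region_rot n p r :
  in_region p r -> in_region (Nat.iter n quarter p) (Nat.iter n rot r).
Proof.
intros H; induction n as [|n IH]; [exact H|].
change (in_region (quarter (Nat.iter n quarter p)) (rot (Nat.iter n rot r))).
destruct (Nat.iter n rot r) as [[a b] c]; destruct IH as (y & z & Hy & Hz & E & ->).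
exists y, z; repeat split; auto.
apply injective_projections; unfold combination, quarter, vtx, rot_vertex, Ci;
simpl; rewrite !opp_IZR; field.
Qed.

(** The four points [i^n w] are quarter turns of one another, so one region [outer] determines four.
    While [w] turns by PI/4, the point [- w^2 / 2] turns by PI/2, whence the [k]-fold rotation of
    [inner]. *)
Definition configuration (outer inner : region) (k : nat) : list region :=
  map (fun n => Nat.iter n rot outer) (List.seq 0 4) ++
  [Nat.iter k rot inner; point_region origin].

Lemma iter_quarter_4 n w : Nat.iter (4 + n) quarter w = Nat.iter n quarter w.
Proof. simpl; unfold quarter; apply injective_projections; simpl; ring. Qed.

Lemma configuration_covers outer inner k m w w' z :
  (m < 4)%nat -> w = Nat.iter m quarter w' -> in_region w' outer ->
  (- (w * w) / 2)%C = Nat.iter k quarter z -> in_region z inner ->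
  covers (configuration outer inner k) (fiber w).
Proof.
intros Hm Hw Ho Hz Hi y [->|[->|(n & Hn & ->)]].
- exists (point_region origin); split; [apply in_or_app; simpl; tauto|].
  apply in_point_region; apply injective_projections; simpl; field.
- exists (Nat.iter k rot inner); split; [apply in_or_app; simpl; tauto|].
  rewrite Hz; now apply in_region_rot.
- assert (E : exists q, (q < 4)%nat /\ Nat.iter n quarter w = Nat.iter q quarter w').
  { rewrite Hw, <- Nat.iter_add.
    destruct (le_lt_dec 4 (n + m)) as [L|L]; [|now exists (n + m)%nat].
    exists (n + m - 4)%nat; split; [lia|].
    rewrite <- (iter_quarter_4 (n + m - 4)); f_equal; lia. }
  destruct E as (q & Hq & ->).
  exists (Nat.iter q rot outer); split; [|now apply in_region_rot].
  apply in_or_app; left; apply (in_map (fun n => Nat.iter n rot outer)), in_seq; lia.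
Qed.

(** On the arc of angles 0 to PI/4 one has [x >= sqrt 2 / 2] and [x + y <= sqrt 2], rounded outwards
    to 0.70 and 1.42; the next octant exchanges the coordinates. The inner triangle has its corner
    where the tangents at the ends of a quarter circle of radius 1/2 meet. *)
Definition stage_regions (k : nat) : list region :=
  configuration
    (if Nat.even k then ((70, 0), (142, 0), (70, 72)) else ((0, 70), (0, 142), (72, 70)))%Z
    ((-50, -50), (-50, 0), (0, -50))%Z k.

(** For odd [k] the coordinates of [i^n w] are irrational, equal to [sqrt 2 / 2] up to sign, so a
    small triangle replaces the point. *)
Definition transition_regions (k : nat) : list region :=
  configuration
    (if Nat.even k then point_region (100, 0) else ((70, 70), (72, 70), (70, 72)))%Z
    (point_region (-50, 0)%Z) k.

Lemma in_even_outer c s : c * c + s * s = 1 -> 0 <= s <= c ->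
  in_region (c, s) ((70, 0), (142, 0), (70, 72))%Z.
Proof.
intros E H; exists ((c - 7 / 10) * (100 / 72)), (s * (100 / 72)).
repeat split; try nra.
apply injective_projections; unfold combination, vtx; simpl; field.
Qed.

Lemma in_odd_outer c s : c * c + s * s = 1 -> 0 <= c <= s ->
  in_region (c, s) ((0, 70), (0, 142), (72, 70))%Z.
Proof.
intros E H; exists ((s - 7 / 10) * (100 / 72)), (c * (100 / 72)).
repeat split; try nra.
apply injective_projections; unfold combination, vtx; simpl; field.
Qed.

Lemma in_odd_transition c : c * c + c * c = 1 -> 0 <= c ->
  in_region (c, c) ((70, 70), (72, 70), (70, 72))%Z.
Proof.
intros E H; exists ((c - 7 / 10) * 50), ((c - 7 / 10) * 50).
repeat split; try nra.
apply injective_projections; unfold combination, vtx; simpl; field.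
Qed.

Lemma in_inner p q : p * p + q * q = 1 -> 0 <= p -> 0 <= q ->
  in_region (- p / 2, - q / 2) ((-50, -50), (-50, 0), (0, -50))%Z.
Proof.
intros E Hp Hq; exists (1 - q), (1 - p); repeat split; try nra.
apply injective_projections; unfold combination, vtx; simpl; field.
Qed.

Lemma octant b : 0 <= b <= PI / 4 -> 0 <= sin b <= cos b.
Proof.
intros Hb; assert (P := PI_RGT_0); split; [apply sin_ge_0; lra|].
rewrite <- (sin_shift b); apply sin_incr_1; lra.
Qed.

Definition octant_sign (k : nat) (c s : R) : Prop :=
  match k with
  | 0%nat => 0 <= s <= c
  | 1%nat => 0 <= c <= s
  | 2%nat => 0 <= - c <= s
  | _ => 0 <= s <= - c
  end.

Lemma octant_sign_stage k t : (k < 4)%nat -> INR k / 4 <= t <= INR (S k) / 4 ->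
  octant_sign k (cos (PI * t)) (sin (PI * t)).
Proof.
intros Hk Ht; rewrite S_INR in Ht; assert (P := PI_RGT_0).
destruct k as [|[|[|[|k]]]]; [| | | |lia]; simpl in Ht; cbn [octant_sign].
- apply octant; nra.
- rewrite <- (sin_shift (PI * t)), <- (cos_shift (PI * t)); apply octant; nra.
- replace (PI * t) with ((PI * t - PI / 2) + PI / 2) by ring.
  destruct (cos_quarters (PI * t - PI / 2)) as ((-> & ->) & _).
  rewrite Ropp_involutive; apply octant; nra.
- replace (- cos (PI * t)) with (cos (PI - PI * t))
    by (rewrite cos_minus, cos_PI, sin_PI; ring).
  rewrite <- (sin_PI_x (PI * t)); apply octant; nra.
Qed.

Lemma stage_cover k t : (k < 4)%nat -> INR k / 4 <= t <= INR (S k) / 4 ->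
  covers (stage_regions k) (fiber (expi (PI * t))).
Proof.
intros Hk Ht; assert (H := octant_sign_stage k t Hk Ht).
unfold expi; set (c := cos (PI * t)) in *; set (s := sin (PI * t)) in *.
assert (E : c * c + s * s = 1) by (generalize (sin2_cos2 (PI * t)); unfold Rsqr; fold c s; lra).
destruct k as [|[|[|[|k]]]]; [| | | |lia]; cbn [octant_sign] in H.
- apply (configuration_covers _ _ 0 0 _ (c, s) (- (c * c - s * s) / 2, - (2 * c * s) / 2));
  [lia|reflexivity|now apply in_even_outer| |apply in_inner; nra].
  apply injective_projections; simpl; field.
- apply (configuration_covers _ _ 1 0 _ (c, s) (- (2 * c * s) / 2, - (s * s - c * c) / 2));
  [lia|reflexivity|now apply in_odd_outer| |apply in_inner; nra].
  apply injective_projections; simpl; field.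
- apply (configuration_covers _ _ 2 1 _ (s, - c) (- (s * s - c * c) / 2, - (- 2 * c * s) / 2));
  [lia| |apply in_even_outer; lra| |apply in_inner; nra];
  apply injective_projections; simpl; field.
- apply (configuration_covers _ _ 3 1 _ (s, - c) (- (- 2 * c * s) / 2, - (c * c - s * s) / 2));
  [lia| |apply in_odd_outer; lra| |apply in_inner; nra];
  apply injective_projections; simpl; field.
Qed.

Lemma transition_cover k : (k <= 4)%nat ->
  covers (transition_regions k) (fiber (expi (PI * (INR k / 4)))).
Proof.
intros Hk.
(* At time [j / 4] the point [w] ends one octant and begins the next; the two sign conditions
   together with the unit norm determine it, without evaluating the cosine at PI/4. *)
assert (A : forall j, (j < 4)%nat ->
  octant_sign j (cos (PI * (INR j / 4))) (sin (PI * (INR j / 4))) /\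
  octant_sign j (cos (PI * (INR (S j) / 4))) (sin (PI * (INR (S j) / 4)))).
{ intros j Hj; rewrite S_INR; split; apply octant_sign_stage; auto; rewrite S_INR; lra. }
unfold expi.
assert (E := sin2_cos2 (PI * (INR k / 4))); unfold Rsqr in E.
destruct k as [|[|[|[|[|k]]]]]; [| | | | |lia].
- rewrite (Rmult_comm PI); simpl INR; unfold Rdiv; rewrite !Rmult_0_l, cos_0, sin_0.
  apply (configuration_covers _ _ 0 0 _ (1, 0) (- 1 / 2, 0));
  [lia|reflexivity|apply in_point_region| |apply in_point_region];
  apply injective_projections; simpl; field.
- destruct (A 0%nat ltac:(lia)) as [_ B1]; destruct (A 1%nat ltac:(lia)) as [B2 _].
  cbn [octant_sign] in *; set (c := cos _) in *; set (s := sin _) in *.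
  replace s with c in * by lra; clearbody c s.
  apply (configuration_covers _ _ 1 0 _ (c, c) (- 1 / 2, 0));
  [lia|reflexivity|apply in_odd_transition; lra| |apply in_point_region];
  apply injective_projections; simpl; lra.
- destruct (A 1%nat ltac:(lia)) as [_ B1]; destruct (A 2%nat ltac:(lia)) as [B2 _].
  cbn [octant_sign] in *; set (c := cos _) in *; set (s := sin _) in *; clearbody c s.
  assert (c = 0) by lra; assert (s = 1) by nra; subst.
  apply (configuration_covers _ _ 2 1 _ (1, 0) (- 1 / 2, 0));
  [lia| |apply in_point_region| |apply in_point_region];
  apply injective_projections; simpl; field.
- destruct (A 2%nat ltac:(lia)) as [_ B1]; destruct (A 3%nat ltac:(lia)) as [B2 _].
  cbn [octant_sign] in *; set (c := cos _) in *; set (s := sin _) in *; clearbody c s.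
  assert (c = - s) by lra; subst c.
  apply (configuration_covers _ _ 3 1 _ (s, s) (- 1 / 2, 0));
  [lia| |apply in_odd_transition; lra| |apply in_point_region];
  apply injective_projections; simpl; lra.
- replace (PI * (INR 4 / 4)) with PI by (simpl; field); rewrite cos_PI, sin_PI.
  apply (configuration_covers _ _ 4 2 _ (1, 0) (- 1 / 2, 0));
  [lia| |apply in_point_region| |apply in_point_region];
  apply injective_projections; simpl; field.
Qed.

(* [stagek_loop] is used for [k / 4 <= t <= (k + 1) / 4]. *)
Definition stage0_loop (j : nat) : list vertex :=
  match j with
  | 1%nat => [(-150, -100); (-62, -80); (-62, 10); (-150, 10); (-150, -100)]
  | 2%nat => [(-55, -60); (6, -60); (6, -45); (-40, 10); (-55, 10); (-55, -60)]
  | 3%nat => [(-30, -140); (-5, -62); (10, -58); (-10, -10); (10, -10); (10, 10);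
      (-10, 10); (-10, -10); (10, -58); (-5, -62); (-30, -140)]
  | 4%nat => [(-10, -150); (85, -110); (85, -62); (-10, -62); (-10, -150)]
  | 5%nat => [(95, -50); (60, -10); (150, -10); (150, 10); (90, 90); (60, 90);
      (60, -10); (95, -50)]
  | _ => [(160, -50); (160, 90); (10, 150); (-85, 110); (-85, 62); (10, 62);
      (10, 150); (160, 90); (160, -50)]
  end%Z.

Definition stage1_loop (j : nat) : list vertex :=
  match j with
  | 1%nat => [(-150, -10); (-62, -10); (-62, 85); (-80, 85); (-150, -10)]
  | 2%nat => [(-85, -100); (8, -150); (8, -62); (-85, -62); (-85, -100)]
  | 3%nat => [(30, -140); (5, -62); (-10, -55); (-10, -10); (10, -10); (10, 10);
      (-10, 10); (-10, -10); (-10, -55); (5, -62); (30, -140)]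
  | 4%nat => [(30, -140); (12, -60); (60, -60); (60, 10); (45, 10); (0, -40);
      (-5, -50); (12, -60); (30, -140)]
  | 5%nat => [(62, -85); (90, -85); (150, -10); (150, 10); (62, 10); (62, -85)]
  | _ => [(160, -50); (160, 50); (85, 85); (30, 150); (-10, 150); (-10, 65);
      (85, 65); (85, 85); (160, 50); (160, -50)]
  end%Z.

(** Two stages turn [w] by a right angle, so the four outer points run through the same regions
    again and their loops are reused. Only the loops around 0 and [- w^2 / 2] are redrawn, the
    latter point being now on the opposite side of 0. *)
Definition stage2_loop (j : nat) : list vertex :=
  match j with
  | 2%nat => [(-30, -140); (-10, -10); (10, -10); (10, 10); (-10, 10); (-10, -10);
      (-30, -140)]
  | 3%nat => [(-30, -140); (-5, -50); (50, -10); (58, 0); (58, 58); (-10, 58);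
      (-10, 45); (50, -10); (-5, -50); (-30, -140)]
  | _ => stage0_loop j
  end%Z.

Definition stage3_loop (j : nat) : list vertex :=
  match j with
  | 3%nat => [(30, -140); (-12, -30); (-55, -10); (-45, -10); (10, 42); (10, 60);
      (-58, 58); (-55, -10); (-12, -30); (30, -140)]
  | 4%nat => [(30, -140); (-10, -10); (10, -10); (10, 10); (-10, 10); (-10, -10);
      (30, -140)]
  | _ => stage1_loop j
  end%Z.

Definition stage_loop (k : nat) : nat -> list vertex :=
  match k with
  | 1%nat => stage0_loop
  | 2%nat => stage1_loop
  | 3%nat => stage2_loop
  | 4%nat => stage3_loop
  | _ => standard_loop
  end.

Definition transition0_word (j : nat) : word :=
  match j with
  | 1%nat => [1]
  | 2%nat => [2]
  | 3%nat => [3]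
  | 4%nat => [-4; 5; 4]
  | 5%nat => [4]
  | _ => [6]
  end%Z.

Definition transition1_word (j : nat) : word :=
  match j with
  | 1%nat => [2]
  | 2%nat => [4]
  | 3%nat => [4; 3; -4]
  | 4%nat => [5]
  | 5%nat => [6]
  | _ => [6; 5; 4; 3; 2; 1; -2; -3; -4; -5; -6]
  end%Z.

Definition transition2_word (j : nat) : word :=
  match j with
  | 1%nat => [1]
  | 2%nat => [4]
  | 3%nat => [4; 2; -4]
  | 4%nat => [4; 3; -4]
  | 5%nat => [5]
  | _ => [6]
  end%Z.

Definition transition4_word (j : nat) : word :=
  match j with
  | 1%nat => [1]
  | 2%nat => [5]
  | 3%nat => [5; 2; -5]
  | 4%nat => [5; 3; -5]
  | 5%nat => [5; 4; -5]
  | _ => [6]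
  end%Z.

(* At time [k / 4] the loop [stage_loop k j] is the product, along this word,
   of the loops [stage_loop (S k)]. *)
Definition transition_word (k : nat) : nat -> word :=
  match k with
  | 0%nat => transition0_word
  | 1%nat | 3%nat => transition1_word
  | 2%nat => transition2_word
  | _ => transition4_word
  end.

Lemma stage_loop_clear k j : (k < 4)%nat ->
  loop_clear (stage_regions k) base (stage_loop (S k) j) = true.
Proof.
intros Hk; destruct k as [|[|[|[|k]]]]; [| | | |lia];
destruct j as [|[|[|[|[|[|[|j]]]]]]]; vm_compute; reflexivity.
Qed.

Lemma stage_loop_clear_transition k j : (k <= 4)%nat ->
  loop_clear (transition_regions k) base (stage_loop (S k) j) = true.
Proof.
intros Hk; destruct k as [|[|[|[|[|k]]]]]; [| | | | |lia];
destruct j as [|[|[|[|[|[|[|j]]]]]]]; vm_compute; reflexivity.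
Qed.

Lemma transition_check k j : (k <= 4)%nat ->
  homotopic_check (transition_regions k) base (stage_loop k j)
    (concat_loops base (stage_loop (S k)) (transition_word k j)) = true.
Proof.
intros Hk; destruct k as [|[|[|[|[|k]]]]]; [| | | | |lia];
destruct j as [|[|[|[|[|[|[|j]]]]]]]; vm_compute; reflexivity.
Qed.

(** * Action of the monodromy on the generators *)

Fixpoint tracked_word (k : nat) (j : nat) : word :=
  match k with
  | 0%nat => transition_word 0 j
  | S k => subst (transition_word (S k)) (tracked_word k j)
  end.

Lemma tracked_monodromy j : reduce (tracked_word 4 j) = reduce (monodromy_word j).
Proof. destruct j as [|[|[|[|[|[|[|j]]]]]]]; vm_compute; reflexivity. Qed.

Section Tracking.

Variables (F G : R -> C -> C).
Hypothesis FG : isotopy F G.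
Hypothesis fibers : forall t y, I01 t -> moved K (F t) y -> fiber (expi (PI * t)) y.

Let stage (k j : nat) : path := polygon (loop_at base (stage_loop k j)).

Let pulled (k j : nat) (t : R) : path := image (G t) (stage k j).

Let quarter_time (k : nat) : R := INR k / 4.

Lemma quarter_time_in k : (k <= 4)%nat -> I01 (quarter_time k).
Proof.
intros Hk; unfold I01, quarter_time.
apply le_INR in Hk; simpl in Hk; assert (H := pos_INR k); lra.
Qed.

Lemma stage_path_in k j : (k <= 4)%nat ->
  path_in (avoid (moved K (F (quarter_time k)))) u0 u0 (stage (S k) j).
Proof.
intros Hk; rewrite <- vtx_base; apply (loop_clear_path_in (transition_regions k)).
- intros y Hy; apply transition_cover; [exact Hk|].
  now apply fibers; [apply quarter_time_in|].
- now apply stage_loop_clear_transition.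
Qed.

Lemma pulled_loops k : (k <= 4)%nat ->
  loops punctured_disk u0 (fun j => pulled (S k) j (quarter_time k)).
Proof.
intros Hk j; eapply hom_path_l, transport_hom; eauto using u0_boundary, quarter_time_in.
now apply hom_refl, stage_path_in.
Qed.

Lemma pulled_transition k j : (k <= 4)%nat ->
  hom punctured_disk u0 u0 (pulled k j (quarter_time k))
    (eval u0 (fun j => pulled (S k) j (quarter_time k)) (transition_word k j)).
Proof.
intros Hk.
assert (H : hom (avoid (moved K (F (quarter_time k)))) u0 u0 (stage k j)
  (eval u0 (stage (S k)) (transition_word k j))).
{ rewrite <- vtx_base; apply (word_check_sound (transition_regions k)).
  - intros y Hy; apply transition_cover; [exact Hk|].
    now apply fibers; [apply quarter_time_in|].
  - intros i; now apply stage_loop_clear_transition.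
  - now apply transition_check. }
apply (transport_hom F G FG) in H; auto using u0_boundary, quarter_time_in.
rewrite image_eval, (iso_inv_boundary F G FG) in H; auto using u0_boundary, quarter_time_in.
Qed.

Lemma pulled_still k j : (k < 4)%nat ->
  hom punctured_disk u0 u0 (pulled (S k) j (quarter_time k))
    (pulled (S k) j (quarter_time (S k))).
Proof.
intros Hk; apply (transport_still F G FG); auto using u0_boundary.
- apply quarter_time_in; lia.
- apply quarter_time_in; lia.
- unfold quarter_time; rewrite S_INR; lra.
- intros t Ht; rewrite <- vtx_base; apply (loop_clear_path_in (stage_regions k)).
  + intros y Hy; apply (stage_cover k t Hk Ht), fibers; [|exact Hy].
    assert (A := quarter_time_in k ltac:(lia)); assert (B := quarter_time_in (S k) Hk).
    unfold I01 in *; lra.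
  + now apply stage_loop_clear.
Qed.

Lemma punctured_u0 : punctured_disk u0.
Proof.
destruct (pulled_loops 0 ltac:(lia) 0%nat) as (_ & H & <- & _); apply H, I01_0.
Qed.

Lemma pulled_tracked k j : (k <= 4)%nat ->
  hom punctured_disk u0 u0 (pulled 0 j 0)
    (eval u0 (fun j => pulled (S k) j (quarter_time k)) (tracked_word k j)).
Proof.
assert (Pu := punctured_u0).
induction k as [|k IH]; intros Hk.
- replace 0 with (quarter_time 0) at 1 by (unfold quarter_time; simpl; field).
  now apply pulled_transition.
- eapply hom_trans; [apply IH; lia|].
  apply hom_trans with
    (eval u0 (fun j => pulled (S k) j (quarter_time (S k))) (tracked_word k j)).
  + apply eval_congr; [exact Pu|]; intros i; apply pulled_still; lia.
  + apply eval_subst; [exact Pu|now apply pulled_loops|].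
    intros i; now apply pulled_transition.
Qed.

Hypothesis fiber_1 : forall z, K z -> moved K (F 1) z.

Lemma standard_loops : loops punctured_disk u0 standard.
Proof.
intros j; apply (path_in_mono (avoid (moved K (F (quarter_time 4))))).
- intros z [Dz Hz]; split; [exact Dz|]; intros Kz; apply Hz.
  replace (quarter_time 4) with 1 by (unfold quarter_time; simpl; field); auto.
- now apply stage_path_in.
Qed.

Lemma K_disk z : K z -> disk z.
Proof. intros H; apply (K_fiber z H). Qed.

(** The motion ends on all of [K], so a loop avoiding the moved punctures at time 1 avoids [K], and
    [F 1] acts on loops of the same space. *)
Lemma push_punctured a b :
  hom punctured_disk u0 u0 a b ->
  hom punctured_disk u0 u0 (image (F 1) a) (image (F 1) b).
Proof.
intros H; apply (hom_mono (avoid (moved K (F 1)))).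
- intros z [Dz Hz]; split; [exact Dz|]; auto.
- apply (push_hom F G FG); auto using u0_boundary, K_disk, I01_1.
Qed.

(** At time 1 the tracking gives [standard j] as a word in the loops [G 1] pulls back from
    [standard]. Applying [F 1] produces the monodromy on the left and cancels [G 1] on the right. *)
Lemma monodromy_standard j :
  hom punctured_disk u0 u0 (image (F 1) (standard j))
    (eval u0 standard (monodromy_word j)).
Proof.
assert (Pu := punctured_u0); assert (HS := standard_loops).
assert (H := pulled_tracked 4 j ltac:(lia)).
replace (quarter_time 4) with 1 in H by (unfold quarter_time; simpl; field).
apply push_punctured in H.
rewrite image_eval, (iso_boundary F G FG 1 u0 I01_1 u0_boundary) in H.
assert (D : forall j s, I01 s -> disk (standard j s))
  by (intros i; exact (avoid_disk K u0 u0 _ (HS i))).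
eapply hom_trans.
{ eapply hom_ext; [exact H| |reflexivity].
  intros s Hs; unfold image, pulled; f_equal.
  now apply iso_inv_0 with F; [|apply D]. }
eapply hom_trans.
{ apply eval_congr; [exact Pu|]; intros i.
  apply (image_cancel _ _ _ _ _ disk); [apply (HS i)|apply (D i)|].
  intros z Dz; apply FG; auto using I01_1. }
(* Index 5 falls in the default branch of [stage_loop], like index 0: the fiber has come back to [K]
   and the standard loops are used again. *)
change (fun j => stage 5 j) with standard.
eapply hom_trans; [apply hom_sym, eval_reduce; auto|].
rewrite tracked_monodromy; now apply eval_reduce.
Qed.

End Tracking.

Theorem corollary5p12 (r : R) (psi beta : C -> C) :
  0 < r < 1 / 2 ->
  induces 6 model_motion psi ->
  local_braid_monodromy beta ->
  same_normal_closure punctured_disk u0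
    (relations (gbase psi r))
    (induced_relations beta (gbase psi r)).
Proof.
intros Hr Hpsi (m & (_ & _ & Km) & Hm & F & HF & Hbeta).
destruct (realizes_isotopy _ _ _ HF) as [G FG].
destruct HF as (_ & _ & _ & _ & HF).
(* From here on the labelling [m] is forgotten: only the set of moved punctures is kept. *)
assert (fibers : forall t y, I01 t -> moved K (F t) y -> fiber (expi (PI * t)) y).
{ intros t y It (p & Kp & <-); apply Km in Kp; destruct Kp as (i & Hi & <-).
  apply curve_fiber, Hm; [exact It|]; exists i; split; [exact Hi|].
  symmetry; now apply HF. }
assert (fiber_1 : forall z, K z -> moved K (F 1) z).
{ intros z Kz; apply K_fiber in Kz.
  replace (RtoC 1) with (expi (2 * PI * 1)) in Kz
    by (unfold expi; rewrite Rmult_1_r, cos_2PI, sin_2PI; reflexivity).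
  apply Hm in Kz; [|apply I01_1]; destruct Kz as (i & Hi & <-).
  exists (m i 0); split; [apply Km; now exists i|].
  apply HF; [exact Hi|apply I01_1]. }
assert (A := fun j => gbase_standard r psi j Hr Hpsi).
assert (Pu := punctured_u0 F G FG fibers).
assert (HX : loops punctured_disk u0 (gbase psi r))
  by (intros j; eapply hom_path_l, A).
apply normal_closures_equal; [exact Pu|exact HX|].
(* The generator is replaced by its polygon before applying [F 1], and the polygons in the resulting
   word are turned back into generators. *)
intros j _; eapply hom_trans.
- eapply hom_ext; [apply (push_punctured F G FG fiber_1), A| |reflexivity].
  intros s Hs; unfold image; symmetry; apply Hbeta.
  exact (avoid_disk K u0 u0 _ (HX j) s Hs).
- eapply hom_trans; [apply (monodromy_standard F G FG fibers fiber_1)|].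
  apply eval_congr; [exact Pu|]; intros i; apply hom_sym, A.
Qed.
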